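(* Let $\beta_0,h_0\in\mathbb R$ be fixed, let $X\sim P_{\beta_0,h_0}$, and suppose there is a finite constant $\gamma>0$ (independent of $N$) with $\max_{i\in[N]}\sum_{j,k}A_{ijk}\le\gamma$ for all $N$. Assume that $T_N(X)=\omega_p(N^{-2/7})$ under $P_{\beta_0,h_0}$, i.e. $P_{\beta_0,h_0}\big(T_N(X)>cN^{-2/7}\big)\to1$ as $N\to\infty$ for every $c>0$. Then, with $P_{\beta_0,h_0}$-probability tending to one, the maximum pseudo-likelihood estimator $(\hat\beta,\hat h)$ exists, and under $P_{\beta_0,h_0}$ $$\max\big(|\hat\beta-\beta_0|,|\hat h-h_0|\big)=O_p\big(N^{-1/2}\,T_N(X)^{-1}\big).$$
   Context: Setting. $\kappa_-<\kappa_+$ are real numbers, $\mu$ is a fixed probability measure on $[\kappa_-,\kappa_+]$ with $\kappa_-,\kappa_+\in\mathrm{supp}(\mu)$, and $\Lambda(\lambda)=\log\int e^{\lambda z}\,d\mu(z)$ for $\lambda\in\mathbb R$. For each $N$, $A=A^{(N)}=(A_{ijk})_{i,j,k\in[N]}$ is a 3-tensor with nonnegative entries, invariant under permutations of its indices, with $A_{ijk}=0$ unless $i,j,k$ are all distinct. For $\beta,h\in\mathbb R$, $P_{\beta,h}$ is the probability measure on $[\kappa_-,\kappa_+]^N$ with density $$\frac{dP_{\beta,h}}{d\mu^{\otimes N}}(x)=\frac{e^{f(x)}}{Z_N(\beta,h)},\qquad f(x)=\frac{\beta}{3}\sum_{i,j,k}A_{ijk}x_ix_jx_k+h\sum_i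 x_i,$$ where $Z_N(\beta,h)$ is the normalizing constant. Put $m_i(x)=\sum_{j,k}A_{ijk}x_jx_k$, $\bar m(x)=\frac1N\sum_i m_i(x)$, and $T_N(x)=\frac1N\sum_i(m_i(x)-\bar m(x))^2$. Maximum pseudo-likelihood estimator (MPLE): given $x$, $(\hat\beta,\hat h)$ is the unique solution $(\beta,h)\in\mathbb R^2$ of $$\sum_i m_i(x)\big(x_i-\Lambda'(\beta m_i(x)+h)\big)=0,\qquad \sum_i\big(x_i-\Lambda'(\beta m_i(x)+h)\big)=0;$$ it is said to exist if such a unique solution exists. $U_N=O_p(V_N)$ means that $U_N/V_N$ is bounded in probability. All asymptotics are as $N\to\infty$. *)

(* Defs.v *)
From HB Require Import structures.
From mathcomp Require Import all_boot all_order all_algebra.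
From mathcomp Require Import all_classical all_reals all_analysis.
From mathcomp Require Import measurable_realfun.
Set Implicit Arguments.
Unset Strict Implicit.
Unset Printing Implicit Defensive.
Import Order.TTheory GRing.Theory Num.Theory.
Import numFieldNormedType.Exports.
Local Open Scope classical_set_scope.
Local Open Scope ring_scope.

Section ProductPower.
Context d (T : measurableType d) (R : realType).

Definition tcons (n : nat) (p : T * n.-tuple T) : n.+1.-tuple T :=
  [tuple of p.1 :: p.2].

Lemma measurable_tcons n : measurable_fun setT (@tcons n).
Proof. exact: measurable_cons. Qed.

HB.instance Definition _ n :=
  @isMeasurableFun.Build _ _ _ _ (@tcons n) (@measurable_tcons n).

(* mu^{\otimes n} on n.-tuple T, as the law of (x_0, (x_1, ..., x_{n-1}))
   under mu \x mu^{\otimes (n-1)}; see [product_power_rect]. *)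
Fixpoint product_power (mu : probability T R) (n : nat) :
    probability (n.-tuple T) R :=
  match n with
  | 0 => \d_[tuple]
  | n'.+1 => distribution (mu \x product_power mu n')%E (@tcons n')
  end.

Lemma product_power_rect (mu : probability T R) n (A : 'I_n -> set T) :
  (forall i, measurable (A i)) ->
  product_power mu n [set x | forall i, A i (tnth x i)] =
  (\prod_(i < n) mu (A i))%E.
Proof.
elim: n A => [|n IHn] A mA /=.
  by rewrite big_ord0 diracE mem_set//= => -[].
rewrite big_ord_recl -IHn; last by move=> i; exact: mA.
set B := [set x : n.-tuple T | _].
have mB : measurable B.
  rewrite (_ : B = \bigcap_(i in [set: 'I_n])
      ((@tnth n T ^~ i) @^-1` A (lift ord0 i))).
    apply: fin_bigcap_measurable => // i _; rewrite -[X in measurable X]setTI.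
    exact: measurable_tnth.
  by apply/seteqP; split => [x Bx i _|x Bx i]; exact: Bx.
rewrite -product_measure1E//=; congr (_ _).
apply/seteqP; split=> -[x y] /=.
  move=> H; split; first by have := H ord0; rewrite tnth0.
  by move=> i; have := H (lift ord0 i); rewrite tnthS.
move=> [Ax By] i; case: (unliftP ord0 i) => [j|] ->.
  by rewrite tnthS; exact: By.
by rewrite tnth0.
Qed.

End ProductPower.

Section Asymptotics.
Context (R : realType).

(* The mass of the largest measurable part of an event.  It is P E for a
   measurable event (see [inner_probE]); it gives a meaning to the probability
   of events such as the existence of an estimator without a measurability
   proof being part of the statement. *)
Definition inner_prob d (T : measurableType d) (P : set T -> \bar R)
    (E : set T) : \bar R :=
  ereal_sup [set P F | F in [set F | measurable F /\ F `<=` E]].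

Lemma inner_probE d (T : measurableType d) (P : {measure set T -> \bar R}) E :
  measurable E -> inner_prob P E = P E.
Proof.
move=> mE; apply/eqP; rewrite eq_le; apply/andP; split.
  apply: ge_ereal_sup => _ [F [mF FE] <-].
  by apply: le_measure => //; exact: mem_set.
by apply: ereal_sup_ubound; exists E; first split.
Qed.

Context (d : nat -> measure_display) (T : forall N, measurableType (d N)).
Context (P : forall N, set (T N) -> \bar R).
Arguments P : clear implicits.

Definition with_high_prob (E : forall N, set (T N)) : Prop :=
  inner_prob (P N) (E N) @[N --> \oo] --> 1%E.

(* V = omega_p(a), for a deterministic sequence a. *)
Definition omega_p (V : forall N, T N -> R) (a : nat -> R) : Prop :=
  forall c : R, 0 < c -> with_high_prob (fun N => [set x | c * a N < V N x]).

(* U = O_p(V): U / V is bounded in probability.  The division is cleared, so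
   that where V = 0 the bound demands U = 0. *)
Definition bigO_p (U V : forall N, T N -> R) : Prop :=
  forall e : R, 0 < e -> exists M : R, \forall N \near \oo,
    ((1 - e)%:E <=
     inner_prob (P N) [set x | `|U N x| <= M * `|V N x|]%R)%E.

End Asymptotics.

Section Model.
Context (R : realType) (mu : probability (measurableTypeR R) R).

Definition measure_support : set R :=
  [set x | forall U : set R, open U -> U x -> (0 < mu U)%E].

(* Lambda, the log-Laplace transform of mu. *)
Definition log_laplace (l : R) : R := ln (\int[mu]_z expR (l * z)).

Definition tensor3 (N : nat) : Type := 'I_N -> 'I_N -> 'I_N -> R.

Definition admissible N (A : tensor3 N) : Prop :=
  [/\ forall i j k, 0 <= A i j k,
      forall i j k, A i j k = A j i k,
      forall i j k, A i j k = A i k j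
    & forall i j k, ~~ [&& i != j, j != k & i != k] -> A i j k = 0].

Section Configurations.
Context (N : nat) (A : tensor3 N).
Local Notation config := (N.-tuple (measurableTypeR R)).

Definition hamiltonian (beta h : R) (x : config) : R :=
  beta / 3 * (\sum_i \sum_j \sum_k A i j k * tnth x i * tnth x j * tnth x k)
  + h * \sum_i tnth x i.

Definition partition_function (beta h : R) : R :=
  \int[product_power mu N]_x expR (hamiltonian beta h x).

(* P_{beta, h} *)
Definition gibbs (beta h : R) (E : set config) : \bar R :=
  (\int[product_power mu N]_(x in E)
     (expR (hamiltonian beta h x) / partition_function beta h)%:E)%E.

Let gibbs_density_ge0 beta h x :
  (0 <= (expR (hamiltonian beta h x) / partition_function beta h)%:E)%E.
Proof.
rewrite lee_fin divr_ge0 ?expR_ge0//; apply: fine_ge0.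
by apply: integral_ge0 => y _; rewrite lee_fin expR_ge0.
Qed.

Lemma measurable_hamiltonian beta h : measurable_fun setT (hamiltonian beta h).
Proof.
have mx i : measurable_fun [set: config] (@tnth N (measurableTypeR R) ^~ i).
  exact: measurable_tnth.
apply: measurable_funD; apply: measurable_funM => //.
  apply: measurable_sum => i; apply: measurable_sum => j.
  apply: measurable_sum => k; apply: measurable_funM; last exact: mx.
  apply: measurable_funM; last exact: mx.
  by apply: measurable_funM => //; exact: mx.
by apply: measurable_sum => i; exact: mx.
Qed.

Let measurable_gibbs_density beta h : measurable_fun setT (fun x =>
  (expR (hamiltonian beta h x) / partition_function beta h)%:E).
Proof.
apply/measurable_EFinP; apply: measurable_funM => //.
by apply: measurableT_comp => //; exact: measurable_hamiltonian.
Qed.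

Let gibbs0 beta h : gibbs beta h set0 = 0%E.
Proof. exact: integral_set0. Qed.

Let gibbs_ge0 beta h E : (0 <= gibbs beta h E)%E.
Proof. by apply: integral_ge0 => x _; exact: gibbs_density_ge0. Qed.

Let gibbs_sigma_additive beta h : semi_sigma_additive (gibbs beta h).
Proof.
move=> F mF tF mUF; rewrite /gibbs ge0_integral_bigcup//=.
- apply: is_cvg_ereal_nneg_natsum_cond => n _ _.
  by apply: integral_ge0 => x _; exact: gibbs_density_ge0.
- by apply: measurable_funTS; exact: measurable_gibbs_density.
Qed.

HB.instance Definition _ beta h := isMeasure.Build _ _ _ (gibbs beta h)
  (gibbs0 beta h) (gibbs_ge0 beta h) (@gibbs_sigma_additive beta h).

Definition local_field (x : config) (i : 'I_N) : R :=
  \sum_j \sum_k A i j k * tnth x j * tnth x k.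

Definition mean_local_field (x : config) : R :=
  N%:R^-1 * \sum_i local_field x i.

(* T_N *)
Definition field_variance (x : config) : R :=
  N%:R^-1 * \sum_i (local_field x i - mean_local_field x) ^+ 2.

Definition pl_equations (x : config) (p : R * R) : Prop :=
  \sum_i local_field x i
    * (tnth x i - derive1 log_laplace (p.1 * local_field x i + p.2)) = 0
  /\ \sum_i (tnth x i - derive1 log_laplace (p.1 * local_field x i + p.2)) = 0.

Definition mple_exists (x : config) : Prop := exists! p, pl_equations x p.

(* The unique solution (beta, h) when there is one, and (0, 0) otherwise. *)
Definition mple (x : config) : R * R :=
  xget (0, 0) [set p | pl_equations x p /\ mple_exists x].

End Configurations.
End Model.

(* Main.v *)
Require Import Defs.
From HB Require Import structures.
From mathcomp Require Import all_boot all_order all_algebra.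
From mathcomp Require Import all_classical all_reals all_analysis.
From mathcomp Require Import measurable_realfun ring lra.
Set Implicit Arguments.
Unset Strict Implicit.
Unset Printing Implicit Defensive.
Import Order.TTheory GRing.Theory Num.Theory.
Import numFieldNormedType.Exports.
Local Open Scope classical_set_scope.
Local Open Scope ring_scope.

(* Proof idea.  Let u_i be the i-th summand of one of the two pseudo-likelihood
   equations at the true parameter (beta0, h0).  Given the other coordinates,
   x_i follows the tilt of mu by beta0 m_i + h0, so u_i is conditionally
   centred; moreover setting x_i := 0 changes u_j by O(sum_k A_jik).  Hence
   |E (u_i u_j)| = O(sum_k A_jik) for i <> j, both sums of the u_i have second
   moment O(N), and both scores are O_p(N^(1/2)).  On the other hand Lambda' is
   strongly monotone on compact sets, and
     sum_i (a m_i + b)^2 = N (a^2 T_N + (a mbar + b)^2)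
   is at least a constant times N T_N max(a^2, b^2).  So on a fixed square
   around (beta0, h0) the negative log-pseudo-likelihood has curvature of order
   N T_N, and as soon as N^(1/2) / (N T_N) is small its minimum over the square
   is an interior critical point within O(N^(-1/2) / T_N) of the centre.  This
   only needs T_N >> N^(-1/2), which follows from T_N >> N^(-2/7).

   Coordinates are clamped to [km, kp] throughout: this changes nothing almost
   surely and makes every function on configurations globally bounded. *)

(** * Integration of bounded measurable functions *)

(** The bound holds everywhere, so this class is closed under sums and products and integrable
    against every probability measure. *)
Definition bmfun d (T : measurableType d) (R : realType) (f : T -> R) : Prop :=
  measurable_fun setT f /\ exists C : R, forall x, `|f x| <= C.

Section BoundedMeasurable.
Context d (T : measurableType d) (R : realType).
Implicit Types f g : T -> R.

Lemma bmf_cst (r : R) : bmfun (fun _ : T => r).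
Proof. by split; [exact: measurable_cst | exists `|r|]. Qed.

Lemma bmfD f g : bmfun f -> bmfun g -> bmfun (fun x => f x + g x).
Proof.
move=> [mf [C fC]] [mg [D gD]]; split; first exact: measurable_funD.
by exists (C + D) => x; rewrite (le_trans (ler_normD _ _))// lerD.
Qed.

Lemma bmfM f g : bmfun f -> bmfun g -> bmfun (fun x => f x * g x).
Proof.
move=> [mf [C fC]] [mg [D gD]]; split; first exact: measurable_funM.
by exists (C * D) => x; rewrite normrM ler_pM.
Qed.

Lemma bmfB f g : bmfun f -> bmfun g -> bmfun (fun x => f x - g x).
Proof.
move=> [mf [C fC]] [mg [D gD]]; split; first exact: measurable_funB.
by exists (C + D) => x; rewrite (le_trans (ler_normB _ _))// lerD.
Qed.

Lemma bmfX f n : bmfun f -> bmfun (fun x => f x ^+ n).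
Proof.
move=> bf; elim: n => [|n IHn]; first exact: bmf_cst.
by under eq_fun do rewrite exprS; exact: bmfM.
Qed.

Lemma bmf_sum I (r : seq I) (F : I -> T -> R) :
  (forall i, bmfun (F i)) -> bmfun (fun x => \sum_(i <- r) F i x).
Proof.
move=> bF; elim: r => [|i r IHr].
  by under eq_fun do rewrite big_nil; exact: bmf_cst.
by under eq_fun do rewrite big_cons; exact: bmfD.
Qed.

Lemma bmf_continuous (h : R -> R) f : continuous h -> bmfun f -> bmfun (h \o f).
Proof.
move=> ch [mf [C fC]]; split.
  by apply: measurableT_comp => //; exact: continuous_measurable_fun.
have C0 (x : T) : 0 <= C by rewrite (le_trans _ (fC x)).
(* If [C < - C], a point of [T] would contradict [C0], so any bound will do. Otherwise [h] is
   bounded on the compact interval [[- C, C]]. *)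
have [CC|CC] := leP (- C) C; last first.
  by exists 0 => x; have {C0} := C0 x; lra.
have cN : {within `[- C, C], continuous (fun t => `|h t|)}.
  apply: continuous_subspaceT => x.
  by apply: continuous_comp; [exact: ch | exact: norm_continuous].
have [c _ hc] := EVT_max CC cN.
exists `|h c| => x; apply: hc.
by rewrite in_itv/= -ler_norml.
Qed.

Lemma bmf_comp d' (T' : measurableType d') (g : T' -> T) f :
  measurable_fun setT g -> bmfun f -> bmfun (f \o g).
Proof.
by move=> mg [mf [C fC]]; split; [exact: measurableT_comp | exists C => x; exact: fC].
Qed.

Lemma bmf_integrable (P : probability T R) f :
  bmfun f -> P.-integrable setT (EFin \o f).
Proof.
move=> [mf [C fC]]; apply: measurable_bounded_integrable => //.
  by apply: (@le_lt_trans _ _ 1%E); [exact: probability_le1 | exact: ltry].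
by exists C; split; [exact: num_real|move=> r Cr x _]; exact: le_trans (fC x) (ltW Cr).
Qed.

End BoundedMeasurable.

Section RintegralBmf.
Context d (T : measurableType d) (R : realType) (P : probability T R).
Implicit Types f g : T -> R.

Lemma bmf_RintegralD f g : bmfun f -> bmfun g ->
  \int[P]_x (f x + g x) = \int[P]_x f x + \int[P]_x g x.
Proof. by move=> bf bg; rewrite RintegralD//; exact: bmf_integrable. Qed.

Lemma bmf_RintegralB f g : bmfun f -> bmfun g ->
  \int[P]_x (f x - g x) = \int[P]_x f x - \int[P]_x g x.
Proof. by move=> bf bg; rewrite RintegralB//; exact: bmf_integrable. Qed.

Lemma bmf_RintegralZ r f : bmfun f ->
  \int[P]_x (r * f x) = r * \int[P]_x f x.
Proof. by move=> bf; rewrite RintegralZl//; exact: bmf_integrable. Qed.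

Lemma bmf_le_Rintegral f g : bmfun f -> bmfun g -> (forall x, f x <= g x) ->
  \int[P]_x f x <= \int[P]_x g x.
Proof. by move=> bf bg fg; apply: le_Rintegral => //; exact: bmf_integrable. Qed.

Lemma bmf_Rintegral_sum I (r : seq I) (F : I -> T -> R) :
  (forall i, bmfun (F i)) ->
  \int[P]_x (\sum_(i <- r) F i x) = \sum_(i <- r) \int[P]_x F i x.
Proof.
move=> bF; elim: r => [|i r IHr].
  under eq_Rintegral do rewrite big_nil.
  by rewrite big_nil Rintegral_cst//= mul0r.
under eq_Rintegral do rewrite big_cons.
by rewrite bmf_RintegralD ?IHr ?big_cons//; exact: bmf_sum.
Qed.

Lemma EFin_Rintegral f : bmfun f -> (\int[P]_x f x)%:E = (\int[P]_x (f x)%:E)%E.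
Proof.
move=> /(bmf_integrable P) iF; rewrite /Rintegral fineK//.
exact: integrable_fin_num.
Qed.

(** Only [f] is assumed bounded: [g] will be an unclamped integrand that agrees with its clamped
    version on a set of full measure. *)
Lemma EFin_Rintegral_ae f g (D : set T) : bmfun f -> measurable_fun setT g ->
  measurable D -> P D = 1%E -> (forall x, D x -> f x = g x) ->
  (\int[P]_x f x)%:E = (\int[P]_x (g x)%:E)%E.
Proof.
move=> bf mg mD PD fg; rewrite EFin_Rintegral//; apply: ae_eq_integral => //.
- by apply/measurable_EFinP; case: bf.
- exact/measurable_EFinP.
- exists (~` D); split; first exact: measurableC.
  + by apply: etrans (probability_setC P mD) _; rewrite PD subee.
  + by move=> x /= nE Dx; apply: nE => _; rewrite fg.
Qed.

Lemma Rintegral_ae f g (D : set T) : bmfun f -> measurable_fun setT g ->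
  measurable D -> P D = 1%E -> (forall x, D x -> f x = g x) ->
  \int[P]_x f x = \int[P]_x g x.
Proof.
by move=> bf mg mD PD fg; rewrite [RHS]/Rintegral -(EFin_Rintegral_ae bf mg mD PD fg).
Qed.

Lemma bmf_indic (E : set T) : measurable E -> bmfun (\1_E : T -> R).
Proof.
move=> mE; split; first exact: measurable_indic.
by exists 1 => x; rewrite indicE; case: (_ \in _); rewrite ?normr1 ?normr0.
Qed.

Lemma Rintegral_indic (E : set T) : measurable E ->
  \int[P]_x \1_E x = fine (P E).
Proof. by move=> mE; rewrite /Rintegral integral_indic// setIT. Qed.

End RintegralBmf.

(** * Resampling one coordinate under a product measure *)

Definition tuple_upd (T : Type) n (x : n.-tuple T) (i : 'I_n) (z : T) :
  n.-tuple T := [tuple if j == i then z else tnth x j | j < n].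

(** By Fubini, coordinate [i] can be integrated first. If it is the head, the inner integral is the
    hypothesis; otherwise the head is frozen and the induction applies to the tail. *)
Lemma product_power_resample d (T : measurableType d) (R : realType)
    (mu : probability T R) n (G : n.-tuple T -> R) (i : 'I_n) :
  bmfun G -> (forall x, \int[mu]_z G (tuple_upd x i z) = 0) ->
  \int[product_power mu n]_x G x = 0.
Proof.
elim: n G i => [|n IHn] G i bG HG; first by case: i HG.
have bGc : bmfun (fun p : T * n.-tuple T => G (tcons p)).
  exact: bmf_comp (@measurable_tcons _ _ _) bG.
have iG : ((mu \x product_power mu n)%E).-integrable setT
    (fun p : T * n.-tuple T => (G (tcons p))%:E).
  exact: (bmf_integrable (mu \x product_power mu n)%E bGc).
have inr (z : T) : bmfun (fun y : n.-tuple T => G (tcons (z, y))).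
  by apply: bmf_comp bGc; exact: measurable_pair1.
have inl (y : n.-tuple T) : bmfun (fun z : T => G (tcons (z, y))).
  by apply: (bmf_comp _ bGc); exact: measurable_pair2.
rewrite /Rintegral integral_distribution//; last first.
  by apply/measurable_EFinP; case: bG.
case: (unliftP ord0 i) HG => [j|] -> HG.
  rewrite -[X in fine X](integral12_prod_meas1 iG).
  rewrite /fubini_F /= -[RHS]/(fine 0%:E); congr fine.
  apply: integral0_eq => z _ /=.
  rewrite -EFin_Rintegral; last exact: inr.
  rewrite (IHn (fun y => G (tcons (z, y))) j (inr z))//.
  move=> y; rewrite -[RHS](HG (tcons (z, y))).
  apply: eq_Rintegral => w _; congr G; apply: eq_from_tnth => k.
  rewrite tnth_mktuple; case: (unliftP ord0 k) => [k'|] ->.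
    by rewrite !tnthS tnth_mktuple (inj_eq (@lift_inj _ ord0)).
  by rewrite !tnth0.
rewrite -[X in fine X](integral21_prod_meas1 iG).
rewrite /fubini_G /= -[RHS]/(fine 0%:E); congr fine.
apply: integral0_eq => y _ /=.
rewrite -EFin_Rintegral; last exact: inl.
(* The head of the tuple is overwritten by the update, so [point] is an arbitrary filler. *)
apply: (congr1 EFin); rewrite -[RHS](HG (tcons (point, y))).
apply: eq_Rintegral => w _; congr G; apply: eq_from_tnth => k.
rewrite tnth_mktuple; case: (unliftP ord0 k) => [k'|] ->.
  by rewrite !tnthS.
by rewrite !tnth0.
Qed.

(** * Log-Laplace transforms of bounded functions *)

Section TiltedMoments.
Context d (T : measurableType d) (R : realType) (P : probability T R).
Variables (g : T -> R) (K v : R).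
Hypothesis mg : measurable_fun setT g.
Hypothesis gK : forall x, `|g x| <= K.

Let K0 : 0 <= K.
Proof. by rewrite (le_trans _ (gK point)). Qed.

Let bg : bmfun g. Proof. by split => //; exists K. Qed.

(** Carrying a weight [w] makes the family stable under differentiation: each derivative multiplies
    [w] by [g]. The weight 1 gives the Laplace transform of [g]. *)
Definition tilt (w : T -> R) (t : R) : R := \int[P]_x (w x * expR (t * g x)).

Let bexp t : bmfun (fun x => expR (t * g x)).
Proof.
apply: (@bmf_continuous _ _ _ expR); first exact: continuous_expR.
by apply: bmfM => //; exact: bmf_cst.
Qed.

Let btilt w t : bmfun w -> bmfun (fun x => w x * expR (t * g x)).
Proof. by move=> bw; exact: bmfM. Qed.

Lemma is_derive_tilt (w : T -> R) (t : R) : bmfun w ->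
  is_derive t 1 (tilt w) (tilt (fun x => w x * g x) t).
Proof.
move=> bw; have [_ [C wC]] := bw.
have C0 : 0 <= C by rewrite (le_trans _ (wC point)).
pose f (s : R) x : R := w x * expR (s * g x).
have df (s : R) (x : T) : is_derive s 1 (f ^~ x) (w x * g x * expR (s * g x)).
  by rewrite /f; apply: is_derive_eq; rewrite /GRing.scale/=; ring.
(* For parameters within distance 1 of [t], this constant dominates the derivative of the
   integrand. *)
pose B := C * K * expR ((`|t| + 1) * K).
have tI : `]t - 1, t + 1[%classic t by rewrite /= in_itv/=; lra.
have := @cvg_differentiation_under_integral R _ T P f setT measurableT t
  (t - 1) (t + 1) tI (fun s _ => bmf_integrable P (btilt s bw))
  (fun s x _ _ => @ex_derive _ _ _ _ _ _ _ (df s x)) (cst B).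
have B0 : 0 <= B by rewrite !mulr_ge0 ?expR_ge0.
move=> /(_ (fun=> B0) (bmf_integrable P (bmf_cst _ B))).
have fB s x : `]t - 1, t + 1[%classic s -> [set: T] x ->
    `|partial1of2 f s x| <= cst B x.
  rewrite /= in_itv/= => st _; rewrite partial1of2E (@derive_val _ _ _ _ _ _ _ (df s x)).
  rewrite /B !normrM ler_pM ?mulr_ge0//; first exact: ler_pM.
  rewrite ger0_norm ?expR_ge0// ler_expR.
  rewrite (le_trans (ler_norm _))// normrM ler_pM//.
  move: st => /andP[]; rewrite ler_norml.
  by have := ler_norm t; have := lerNnormlW (lexx `|t|); lra.
move=> /(_ fB) cv.
have dE : \int[P]_y partial1of2 f t y = tilt (fun x => w x * g x) t.
  apply: eq_Rintegral => x _.
  by rewrite partial1of2E (@derive_val _ _ _ _ _ _ _ (df t x)).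
move: cv; rewrite dE => cv; split.
  by apply/cvg_ex; exists (tilt (fun x => w x * g x) t) => /=;
    under eq_fun do rewrite scaler1.
rewrite /derive; apply: cvg_lim; first exact: norm_hausdorff.
by under eq_fun do rewrite scaler1.
Qed.

Local Notation M := (tilt (fun=> 1)).

(** Mean and variance of [g] under the law with density proportional to [expR (t * g x)]. The
    centred form of [cgf2] serves its sign and its lower bound; [cgf2E] gives the form produced by
    the quotient rule. *)
Definition cgf1 (t : R) : R := tilt g t / M t.
Definition cgf2 (t : R) : R := tilt (fun x => (g x - cgf1 t) ^+ 2) t / M t.

Lemma le_tilt (w1 w2 : T -> R) t : bmfun w1 -> bmfun w2 ->
  (forall x, w1 x <= w2 x) -> tilt w1 t <= tilt w2 t.
Proof.
move=> b1 b2 w12; apply: bmf_le_Rintegral; [exact: btilt..|] => x.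
by rewrite ler_wpM2r ?expR_ge0.
Qed.

Lemma tiltZ a (w : T -> R) t : bmfun w ->
  tilt (fun x => a * w x) t = a * tilt w t.
Proof.
move=> bw; rewrite /tilt -bmf_RintegralZ; last exact: btilt.
by apply: eq_Rintegral => x _; rewrite mulrA.
Qed.

Lemma tiltB (w1 w2 : T -> R) t : bmfun w1 -> bmfun w2 ->
  tilt (fun x => w1 x - w2 x) t = tilt w1 t - tilt w2 t.
Proof.
move=> b1 b2; rewrite /tilt -bmf_RintegralB; [|exact: btilt..].
by apply: eq_Rintegral => x _; rewrite mulrBl.
Qed.

Lemma tiltD (w1 w2 : T -> R) t : bmfun w1 -> bmfun w2 ->
  tilt (fun x => w1 x + w2 x) t = tilt w1 t + tilt w2 t.
Proof.
move=> b1 b2; rewrite /tilt -bmf_RintegralD; [|exact: btilt..].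
by apply: eq_Rintegral => x _; rewrite mulrDl.
Qed.

Let tgK t x : `|t * g x| <= `|t| * K.
Proof. by rewrite normrM ler_wpM2l. Qed.

Let b1 : bmfun (fun _ : T => 1 : R). Proof. exact: bmf_cst. Qed.

Let P1 : fine (P setT) = 1. Proof. by rewrite probability_setT. Qed.

Lemma tilt1_ge t : expR (- (`|t| * K)) <= M t.
Proof.
rewrite -[leLHS]mulr1 -[X in _ * X <= _]P1.
rewrite -Rintegral_cst//; apply: bmf_le_Rintegral; first exact: bmf_cst.
  exact: btilt.
move=> x; rewrite mul1r ler_expR.
by have := tgK t x; rewrite ler_norml => /andP[].
Qed.

Lemma tilt1_le t : M t <= expR (`|t| * K).
Proof.
rewrite -[leRHS]mulr1 -[X in _ <= _ * X]P1.
rewrite -Rintegral_cst//; apply: bmf_le_Rintegral; last 1 first.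
- move=> x; rewrite mul1r ler_expR.
  by have := tgK t x; rewrite ler_norml => /andP[].
- exact: btilt.
- exact: bmf_cst.
Qed.

Lemma tilt1_gt0 t : 0 < M t.
Proof. by rewrite (lt_le_trans _ (tilt1_ge t))// expR_gt0. Qed.

Lemma is_derive_tilt1 (t : R) : is_derive t 1 M (tilt g t).
Proof.
apply: is_derive_eq; first exact: is_derive_tilt.
by congr (tilt _ t); apply/funext => x; rewrite mul1r.
Qed.

Lemma is_derive_cgf (t : R) : is_derive t 1 (fun s => ln (M s)) (cgf1 t).
Proof.
have d1 := is_derive_tilt1 t.
have d2 := is_derive1_ln (tilt1_gt0 t).
have := @is_derive1_comp R (@ln R) M t _ _ d2 d1.
by rewrite /cgf1 mulrC.
Qed.

(** This cancellation is what makes a score summand conditionally centred given the other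
    coordinates. *)
Lemma tilt_centered t : tilt (fun x => g x - cgf1 t) t = 0.
Proof.
rewrite tiltB//; last exact: bmf_cst.
rewrite -[X in tilt (fun=> X)]mulr1 (tiltZ _ _ b1) /cgf1 divfK ?subrr//.
by rewrite gt_eqF ?tilt1_gt0.
Qed.

Lemma cgf2E t : cgf2 t = (tilt (fun x => g x * g x) t * M t - tilt g t ^+ 2) / M t ^+ 2.
Proof.
have M0 : M t != 0 by rewrite gt_eqF ?tilt1_gt0.
have -> : cgf2 t = (tilt (fun x => g x * g x) t - 2 * cgf1 t * tilt g t
    + cgf1 t ^+ 2 * M t) / M t.
  rewrite /cgf2; congr (_ / _).
  rewrite -!tiltZ// -tiltB; [|exact: bmfM|by apply: bmfM => //; exact: bmf_cst].
  rewrite -tiltD; last 2 first.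
  - by apply: bmfB; [exact: bmfM|apply: bmfM => //; exact: bmf_cst].
  - by apply: bmfM => //; exact: bmf_cst.
  by congr (tilt _ t); apply/funext => x; ring.
by rewrite /cgf1; field.
Qed.

Lemma is_derive_cgf1 (t : R) : is_derive t 1 cgf1 (cgf2 t).
Proof.
have M0 : M t != 0 by rewrite gt_eqF ?tilt1_gt0.
have d1 := is_derive_tilt1 t.
have d2 := is_derive_tilt t bg.
have d3 := is_deriveV M0 d1.
have := is_deriveM d2 d3.
move/is_derive_eq; apply; rewrite cgf2E /GRing.scale/=.
by field.
Qed.

Lemma continuous_cgf1 : continuous cgf1.
Proof.
move=> t; apply: differentiable_continuous; apply/derivable1_diffP.
by have := is_derive_cgf1 t => -[].
Qed.

Lemma cgf1_le t : `|cgf1 t| <= K.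
Proof.
have bK c : bmfun (fun _ : T => c) by exact: bmf_cst.
have M0 := tilt1_gt0 t.
rewrite ler_norml /cgf1 ler_pdivlMr// ler_pdivrMr// -!tiltZ//.
have gKK x : - K <= g x <= K by rewrite -ler_norml.
by apply/andP; split; apply: le_tilt => //;
  move=> x; rewrite mulr1; have /andP[] := gKK x.
Qed.

Lemma cgf2_ge0 t : 0 <= cgf2 t.
Proof.
rewrite /cgf2 divr_ge0 ?(ltW (tilt1_gt0 t))//.
by apply: Rintegral_ge0 => x _; rewrite mulr_ge0 ?sqr_ge0 ?expR_ge0.
Qed.

Let bsq a : bmfun (fun x => (g x - a) ^+ 2).
Proof. by apply: bmfX; apply: bmfB => //; exact: bmf_cst. Qed.

Lemma cgf2_le t : cgf2 t <= (2 * K) ^+ 2.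
Proof.
rewrite /cgf2 ler_pdivrMr ?tilt1_gt0// -tiltZ//; apply: le_tilt => //.
  by apply: bmfM => //; exact: bmf_cst.
move=> x; rewrite mulr1 -(real_normK (num_real (g x - _))) lerXn2r ?nnegrE//.
  by rewrite mulr_ge0.
by rewrite (le_trans (ler_normB _ _))// mulrDl mul1r lerD// cgf1_le.
Qed.

(** The centre [cgf1 t] moves with [t], hence a bound [v] valid for every centre. Tilting costs a
    factor [expR (- (|t| * K))] in the numerator, and dividing by [M t] costs it once more. *)
Lemma cgf2_ge t : (forall a, v <= \int[P]_x (g x - a) ^+ 2) ->
  0 <= v -> v * expR (- (2 * `|t| * K)) <= cgf2 t.
Proof.
move=> hv v0; rewrite /cgf2 ler_pdivlMr ?tilt1_gt0//.
have -> : expR (- (2 * `|t| * K)) = expR (- (`|t| * K)) * expR (- (`|t| * K)).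
  by rewrite -expRD; congr expR; ring.
rewrite (mulrA v) -(mulrA (v * _)).
apply: (@le_trans _ _ (v * expR (- (`|t| * K)))).
  rewrite -[leRHS]mulr1 ler_wpM2l ?mulr_ge0 ?expR_ge0//.
  rewrite -[leRHS](@expRxMexpNx_1 _ (`|t| * K)) [leLHS]mulrC.
  by rewrite ler_wpM2r ?expR_ge0 ?tilt1_le.
apply: (@le_trans _ _ (expR (- (`|t| * K)) * \int[P]_x (g x - cgf1 t) ^+ 2)).
  by rewrite mulrC ler_wpM2l ?expR_ge0.
rewrite -bmf_RintegralZ//; apply: bmf_le_Rintegral.
- by apply: bmfM => //; exact: bmf_cst.
- exact: btilt.
- move=> x; rewrite mulrC ler_wpM2l ?sqr_ge0// ler_expR.
  by have := tgK t x; rewrite ler_norml => /andP[].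
Qed.

Let cgf1_MVT s t : s <= t -> exists2 c, c \in `[s, t]%R &
  cgf1 t - cgf1 s = cgf2 c * (t - s).
Proof.
move=> st; apply: MVT_segment => //; first by move=> x _; exact: is_derive_cgf1.
by apply: continuous_subspaceT; exact: continuous_cgf1.
Qed.

Lemma cgf1_lipschitz s t : `|cgf1 t - cgf1 s| <= (2 * K) ^+ 2 * `|t - s|.
Proof.
wlog st : s t / s <= t.
  move=> H; have [|/ltW ts] := leP s t; first exact: H.
  by rewrite distrC [X in _ * X]distrC; exact: H.
have [c _ ->] := cgf1_MVT st.
by rewrite normrM ler_wpM2r// ger0_norm ?cgf2_ge0 ?cgf2_le.
Qed.

(** The mean value theorem gives an intermediate point that still lies in [[- B, B]], where
    [cgf2_ge] bounds the slope uniformly. *)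
Lemma cgf1_strong_monotone B s t :
  (forall a, v <= \int[P]_x (g x - a) ^+ 2) -> 0 <= v ->
  `|s| <= B -> `|t| <= B ->
  v * expR (- (2 * B * K)) * (t - s) ^+ 2 <= (t - s) * (cgf1 t - cgf1 s).
Proof.
move=> hv v0; wlog st : s t / s <= t.
  move=> H sB tB; have [st|/ltW ts] := leP s t; first exact: H.
  have -> : (t - s) * (cgf1 t - cgf1 s) = (s - t) * (cgf1 s - cgf1 t).
    by rewrite -mulrNN !opprB.
  by rewrite -sqrrN opprB; exact: H.
move=> sB tB; have [c cst ->] := cgf1_MVT st.
have cB : `|c| <= B.
  move: cst sB tB; rewrite in_itv/= !ler_norml => /andP[sc ct] /andP[Bs _] /andP[_ tB].
  by rewrite (le_trans Bs sc) (le_trans ct tB).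
have -> : (t - s) * (cgf2 c * (t - s)) = cgf2 c * (t - s) ^+ 2 by ring.
rewrite ler_wpM2r ?sqr_ge0// (le_trans _ (cgf2_ge c hv v0))// ler_wpM2l//.
by rewrite ler_expR lerN2 ler_wpM2r// ler_wpM2l.
Qed.

End TiltedMoments.

(** * Deterministic analysis of the pseudo-likelihood equations *)

Section SampleVariance.
Context (R : realType) (N : nat) (m : 'I_N -> R).

(** For [m] the local fields, these two definitions are convertible to [mean_local_field] and
    [field_variance]. *)
Definition sample_mean : R := N%:R^-1 * \sum_i m i.
Definition sample_var : R := N%:R^-1 * \sum_i (m i - sample_mean) ^+ 2.

Hypothesis N0 : (0 < N)%N.
Let nN : N%:R != 0 :> R. Proof. by rewrite pnatr_eq0 -lt0n. Qed.
Let N_gt0 : 0 < N%:R :> R. Proof. by rewrite ltr0n. Qed.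

Lemma sum_affine_sqr a b :
  \sum_i (a * m i + b) ^+ 2 = N%:R * (a ^+ 2 * sample_var + (a * sample_mean + b) ^+ 2).
Proof.
(* The same expansion serves twice: for the left-hand side and for the squares inside
   [sample_var]. *)
have E c d : \sum_i (c * m i + d) ^+ 2 =
    c ^+ 2 * \sum_i m i ^+ 2 + 2 * c * d * \sum_i m i + N%:R * d ^+ 2.
  have -> : N%:R * d ^+ 2 = \sum_(i < N) d ^+ 2.
    by rewrite sumr_const card_ord mulr_natl.
  by rewrite !mulr_sumr -!big_split; apply: eq_bigr => i _ /=; ring.
have -> : sample_var = N%:R^-1 * \sum_i (1 * m i + - sample_mean) ^+ 2.
  by congr (_ * _); apply: eq_bigr => i _; rewrite mul1r.
by rewrite !E /sample_mean; field.
Qed.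

Lemma sample_mean_le D : (forall i, `|m i| <= D) -> `|sample_mean| <= D.
Proof.
move=> mD; rewrite /sample_mean normrM ger0_norm ?invr_ge0// ler_pdivrMl//.
rewrite (le_trans (ler_norm_sum _ _ _))//.
rewrite (le_trans (ler_sum _ (fun i _ => mD i)))//.
by rewrite sumr_const card_ord mulr_natl lexx.
Qed.

Lemma sample_var_le D : (forall i, `|m i| <= D) -> sample_var <= D ^+ 2.
Proof.
move=> mD; have := sum_affine_sqr 1 0.
have H : \sum_i (1 * m i + 0) ^+ 2 <= N%:R * D ^+ 2.
  rewrite (_ : N%:R * D ^+ 2 = \sum_(i < N) D ^+ 2); last first.
    by rewrite sumr_const card_ord mulr_natl.
  apply: ler_sum => i _; rewrite mul1r addr0.
  rewrite -(real_normK (num_real (m i))) lerXn2r ?nnegrE//.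
  by rewrite (le_trans _ (mD i)).
move=> E; move: H (sqr_ge0 (1 * sample_mean + 0)).
by rewrite E ler_pM2l// expr1n mul1r; lra.
Qed.

Lemma sample_var_ge0 : 0 <= sample_var.
Proof. by rewrite mulr_ge0 ?invr_ge0// sumr_ge0// => i _; exact: sqr_ge0. Qed.

(** Let V be the sample variance and c = a mean + b, so that the sum is N (a^2 V + c^2). If |a| is
    the maximum, the term a^2 V suffices. Otherwise b = c - a mean gives b^2 <= 2 c^2 + 2 a^2
    mean^2; multiplying by V and bounding V and mean^2 by D^2 gives the factor 2 D^2. *)
Lemma affine_sqr_lower D a b : (forall i, `|m i| <= D) ->
  N%:R * sample_var * Num.max `|a| `|b| ^+ 2
    <= (1 + 2 * D ^+ 2) * \sum_i (a * m i + b) ^+ 2.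
Proof.
move=> mD; rewrite sum_affine_sqr.
rewrite -mulrA [leRHS](mulrCA _ N%:R) ler_pM2l//.
have V0 := sample_var_ge0; have VD := sample_var_le mD.
have aD : sample_mean ^+ 2 <= D ^+ 2.
  rewrite -(real_normK (num_real sample_mean)) lerXn2r ?nnegrE ?sample_mean_le//.
  by rewrite (le_trans (normr_ge0 _) (sample_mean_le mD)).
have D0 := sqr_ge0 D.
have Ea : `|a| ^+ 2 = a ^+ 2 by exact: real_normK (num_real a).
have Eb : `|b| ^+ 2 = b ^+ 2 by exact: real_normK (num_real b).
set c := a * sample_mean + b.
have Q0 : 0 <= a ^+ 2 * sample_var + c ^+ 2.
  by apply: addr_ge0; [apply: mulr_ge0|]; rewrite ?sqr_ge0.
have [_|_] := leP `|a| `|b|; rewrite ?Ea ?Eb; last first.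
  by rewrite mulrDl mul1r; have := mulr_ge0 D0 Q0; have := sqr_ge0 c; lra.
have b2 : b ^+ 2 <= 2 * c ^+ 2 + 2 * (a ^+ 2 * sample_mean ^+ 2).
  rewrite -subr_ge0 (_ : _ - _ = (c + a * sample_mean) ^+ 2) ?sqr_ge0//.
  by rewrite /c; ring.
apply: (@le_trans _ _ (sample_var * (2 * c ^+ 2 + 2 * (a ^+ 2 * sample_mean ^+ 2)))).
  by rewrite ler_wpM2l.
apply: (@le_trans _ _ (2 * D ^+ 2 * (a ^+ 2 * sample_var + c ^+ 2))); last by lra.
rewrite mulrDr [leRHS]mulrDr addrC lerD//.
- rewrite (_ : sample_var * _ = 2 * (a ^+ 2 * sample_var) * sample_mean ^+ 2);
    last by ring.
  rewrite (_ : 2 * D ^+ 2 * _ = 2 * (a ^+ 2 * sample_var) * D ^+ 2); last by ring.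
  by rewrite ler_wpM2l// mulr_ge0// mulr_ge0// sqr_ge0.
- rewrite (_ : 2 * D ^+ 2 * _ = D ^+ 2 * (2 * c ^+ 2)); last by ring.
  by rewrite ler_wpM2r// mulr_ge0// sqr_ge0.
Qed.

End SampleVariance.

(** Minimality on one side suffices, since a negative derivative forces a negative quotient at small
    positive times. This suits a minimiser over a square, possibly on its boundary. *)
Lemma derive_ge0_at_min (R : realType) (f : R -> R) (df : R) :
  is_derive (0 : R) 1 f df -> (forall t : R, 0 <= t <= 1 -> f 0 <= f t) -> 0 <= df.
Proof.
move=> fd fmin; rewrite leNgt; apply/negP => df0.
have [fdr fdv] := fd.
have cv : h^-1 *: (f (h *: 1 + 0) - f 0) @[h --> 0^'] --> df.
  by rewrite -fdv; exact: fdr.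
have ndf : 0 < - df by rewrite oppr_gt0.
move/cvgrPdist_lt : cv => /(_ _ ndf) /=.
move=> [e /= e0 He].
pose h := Num.min 1 (e / 2).
have h0 : 0 < h by rewrite lt_min ltr01 divr_gt0.
have h1 : h <= 1 by rewrite ge_min lexx.
have he : h <= e / 2 by rewrite ge_min lexx orbT.
have := He h; rewrite /ball/= sub0r normrN gtr0_norm//.
have hlt : h < e by lra.
move=> /(_ hlt (lt0r_neq0 h0)).
rewrite scaler1 addr0 ltr_norml => /andP[lo _].
have : 0 <= h^-1 *: (f h - f 0).
  by rewrite /GRing.scale/= mulr_ge0 ?invr_ge0 ?(ltW h0)// subr_ge0 fmin// (ltW h0) h1.
by lra.
Qed.

(** * Existence, uniqueness and location of the root of the scores *)

Section PseudoLikelihood.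
Context (R : realType) (N : nat) (m x : 'I_N -> R) (L L1 : R -> R).
Hypothesis dL : forall t : R, is_derive t 1 L (L1 t).
Hypothesis L1_mono : forall s t, s != t -> 0 < (t - s) * (L1 t - L1 s).
Hypothesis N0 : (0 < N)%N.

Definition score1 (p : R * R) : R := \sum_i m i * (x i - L1 (p.1 * m i + p.2)).
Definition score2 (p : R * R) : R := \sum_i (x i - L1 (p.1 * m i + p.2)).

Definition neg_log_pl (p : R * R) : R :=
  \sum_i (L (p.1 * m i + p.2) - x i * (p.1 * m i + p.2)).

Let continuous_L : continuous L.
Proof.
move=> t; apply: differentiable_continuous; apply/derivable1_diffP.
by have := dL t => -[].
Qed.

Lemma continuous_neg_log_pl : continuous neg_log_pl.
Proof.
rewrite /neg_log_pl => p; elim: (index_enum _) => [|i r IHr].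
  by under eq_fun do rewrite big_nil; exact: cvg_cst.
under eq_fun do rewrite big_cons.
apply: cvgD; last exact: IHr.
have ca : (q.1 * m i + q.2) @[q --> p] --> p.1 * m i + p.2.
  by apply: cvgD; [apply: cvgM; [exact: cvg_fst|exact: cvg_cst]|exact: cvg_snd].
apply: cvgB; last by apply: cvgM => //; exact: cvg_cst.
by apply: (cvg_comp _ _ ca); exact: continuous_L.
Qed.

(** Derivatives along lines at time 0 reduce the two-variable minimisation to one-variable
    calculus. *)
Lemma is_derive_neg_log_pl (p : R * R) (u w : R) :
  is_derive (0 : R) 1 (fun t => neg_log_pl (p.1 + t * u, p.2 + t * w))
    (- (u * score1 p + w * score2 p)).
Proof.
have di (i : 'I_N) : is_derive (0 : R) 1
    (fun t : R => L ((p.1 + t * u) * m i + (p.2 + t * w))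
       - x i * ((p.1 + t * u) * m i + (p.2 + t * w)))
    (- (u * (m i * (x i - L1 (p.1 * m i + p.2))) + w * (x i - L1 (p.1 * m i + p.2)))).
  pose a (t : R) : R := (p.1 + t * u) * m i + (p.2 + t * w).
  have da : is_derive (0 : R) 1 a (u * m i + w).
    by rewrite /a; apply: is_derive_eq; rewrite /GRing.scale/=; ring.
  have a0 : a 0 = p.1 * m i + p.2 by rewrite /a !mul0r !addr0.
  have dLa := @is_derive1_comp R L a 0 _ _ (dL (a 0)) da.
  have dx : is_derive (0 : R) 1 (fun t => x i * a t) (x i * (u * m i + w)).
    by apply: is_derive_eq; rewrite /GRing.scale/=; ring.
  have := is_deriveB dLa dx.
  by move/is_derive_eq; apply; rewrite a0; ring.
have := is_derive_sum di.
rewrite (_ : \sum_(i < N) _ = fun t => neg_log_pl (p.1 + t * u, p.2 + t * w)); last first.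
  by apply/funext => t; rewrite fct_sumE.
move/is_derive_eq; apply.
by rewrite /score1 /score2 !mulr_sumr -big_split/= -sumrN.
Qed.

(** The observations [x i] cancel in a difference of scores, which is therefore controlled by the
    monotonicity of [L1] alone. *)
Lemma score_mono p q :
  \sum_i ((q.1 * m i + q.2) - (p.1 * m i + p.2)) *
    (L1 (q.1 * m i + q.2) - L1 (p.1 * m i + p.2)) =
  (q.1 - p.1) * (score1 p - score1 q) + (q.2 - p.2) * (score2 p - score2 q).
Proof.
rewrite /score1 /score2 -!sumrB !mulr_sumr -big_split/=.
by apply: eq_bigr => i _; ring.
Qed.

(** For two roots, [score_mono] is a vanishing sum of nonnegative terms, so by strict monotonicity
    their affine predictors agree at every [m i]. Positive sample variance then forces equal
    coefficients. As [L1_mono] is global, uniqueness holds in the whole plane. *)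
Lemma score_root_unique p q : 0 < sample_var m ->
  score1 p = 0 -> score2 p = 0 -> score1 q = 0 -> score2 q = 0 -> p = q.
Proof.
move=> V0 p1 p2 q1 q2; have := score_mono p q.
rewrite p1 p2 q1 q2 subrr !mulr0 addr0.
move=> /eqP; rewrite psumr_eq0; last first.
  move=> i _; have [->|ne] := eqVneq (p.1 * m i + p.2) (q.1 * m i + q.2).
    by rewrite subrr mul0r.
  exact/ltW/L1_mono.
move=> /allP H.
have E i : (q.1 - p.1) * m i + (q.2 - p.2) = 0.
  have /= := H i; rewrite mem_index_enum => /(_ isT) /eqP Hi.
  have [E|ne] := eqVneq (p.1 * m i + p.2) (q.1 * m i + q.2).
    have -> : (q.1 - p.1) * m i + (q.2 - p.2) =
      (q.1 * m i + q.2) - (p.1 * m i + p.2) by ring.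
    by rewrite E subrr.
  by have := L1_mono ne; rewrite Hi ltxx.
have := sum_affine_sqr m N0 (q.1 - p.1) (q.2 - p.2).
rewrite big1; last by move=> i _; rewrite E expr0n.
move/esym/eqP; rewrite mulf_eq0 pnatr_eq0 -leqn0 leqNgt N0/=.
rewrite paddr_eq0 ?sqr_ge0//; last by apply: mulr_ge0; [exact: sqr_ge0|exact: ltW].
rewrite mulf_eq0 (gt_eqF V0) orbF !sqrf_eq0 => /andP[/eqP E1].
rewrite E1 mul0r add0r => /eqP E2.
by rewrite [p]surjective_pairing [q]surjective_pairing; congr pair; lra.
Qed.

Variables (D kappa s : R) (p0 : R * R).
(** [B] bounds the linear predictors over the unit square around [p0]. The constant [eta] is the
    curvature per unit of N times the sample variance, with the loss from [affine_sqr_lower]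
    included. *)
Let B := (`|p0.1| + 1) * D + (`|p0.2| + 1).
Let eta := kappa / (1 + 2 * D ^+ 2).
Hypothesis mD : forall i, `|m i| <= D.
Hypothesis kappa0 : 0 < kappa.
Hypothesis L1_strong : forall u t, `|u| <= B -> `|t| <= B ->
  kappa * (t - u) ^+ 2 <= (t - u) * (L1 t - L1 u).
Hypothesis s1 : `|score1 p0| <= s.
Hypothesis s2 : `|score2 p0| <= s.
Hypothesis sample_var_gt0 : 0 < sample_var m.

Let D1 : 0 < 1 + 2 * D ^+ 2.
Proof. by have := sqr_ge0 D; lra. Qed.

Let eta0 : 0 < eta. Proof. by rewrite divr_gt0. Qed.

Let dist p := Num.max `|p.1 - p0.1| `|p.2 - p0.2|.

Let theta_le p i : dist p <= 1 -> `|p.1 * m i + p.2| <= B.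
Proof.
have tri (a b : R) : `|a - b| <= 1 -> `|a| <= `|b| + 1.
  move=> ab; rewrite -[X in `|X| <= _](subrK b) addrC.
  by rewrite (le_trans (ler_normD _ _))// lerD2l.
rewrite ge_max => /andP[d1 d2]; rewrite /B (le_trans (ler_normD _ _))// lerD ?tri//.
by rewrite normrM ler_pM// tri.
Qed.

Let dist_p0 : dist p0 = 0. Proof. by rewrite /dist !subrr normr0 maxxx. Qed.

Let dist_ge0 p : 0 <= dist p. Proof. by rewrite le_max normr_ge0. Qed.

(* A point near [p0] at which the objective does not decrease towards [p0] is
   close to [p0], by strong monotonicity of the score. *)
Let dist_bound p : dist p <= 1 ->
  0 <= (p.1 - p0.1) * score1 p + (p.2 - p0.2) * score2 p ->
  dist p <= 2 * s / (eta * (N%:R * sample_var m)).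
Proof.
move=> d1 sp.
have NV : 0 < N%:R * sample_var m by rewrite mulr_gt0// ltr0n.
have H1 : kappa * \sum_i ((p.1 - p0.1) * m i + (p.2 - p0.2)) ^+ 2 <=
    (p.1 - p0.1) * (score1 p0 - score1 p) + (p.2 - p0.2) * (score2 p0 - score2 p).
  rewrite -score_mono mulr_sumr; apply: ler_sum => i _.
  have -> : (p.1 - p0.1) * m i + (p.2 - p0.2) =
    (p.1 * m i + p.2) - (p0.1 * m i + p0.2) by ring.
  by apply: L1_strong; apply: theta_le => //; rewrite dist_p0.
have H2 := affine_sqr_lower N0 (p.1 - p0.1) (p.2 - p0.2) mD.
(* The terms at [p] have a favourable sign and drop out, leaving a quadratic bounded by a linear
   function of the distance. *)
have H3 : eta * (N%:R * sample_var m) * dist p ^+ 2 <= dist p * (2 * s).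
  apply: (@le_trans _ _ (kappa * \sum_i ((p.1 - p0.1) * m i + (p.2 - p0.2)) ^+ 2)).
    rewrite /eta -!mulrA ler_pM2l// ler_pdivrMl//.
    by rewrite !mulrA in H2 *.
  apply: (le_trans H1).
  have B1 : (p.1 - p0.1) * score1 p0 <= dist p * s.
    rewrite (le_trans (ler_norm _))// normrM ler_pM// le_max lexx//.
  have B2 : (p.2 - p0.2) * score2 p0 <= dist p * s.
    by rewrite (le_trans (ler_norm _))// normrM ler_pM// le_max lexx orbT.
  by rewrite !mulrBr; lra.
have ENV : 0 < eta * (N%:R * sample_var m) by rewrite mulr_gt0.
have [->|dn0] := eqVneq (dist p) 0.
  by rewrite divr_ge0 ?(ltW ENV)// mulr_ge0// (le_trans _ s1).
have d0 : 0 < dist p by rewrite lt_def dn0 dist_ge0.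
by rewrite ler_pdivlMr// -(ler_pM2l d0) (le_trans _ H3)// expr2; lra.
Qed.

(** A minimiser over the compact unit square exists. Moving it towards [p0] places it within
    [rho < 1] of [p0], hence in the interior, where both partial derivatives vanish. *)
Lemma score_root_exists : 2 * s / (eta * (N%:R * sample_var m)) < 1 ->
  exists p, [/\ score1 p = 0, score2 p = 0 &
    dist p <= 2 * s / (eta * (N%:R * sample_var m))].
Proof.
set rho := _ / _ => rho1.
pose A := (`[p0.1 - 1, p0.1 + 1] `*` `[p0.2 - 1, p0.2 + 1])%classic.
have AP p : A p <-> dist p <= 1.
  rewrite /A/= !in_itv/= ge_max !ler_norml.
  split=> [[/andP[? ?] /andP[? ?]]|/andP[/andP[? ?] /andP[? ?]]].
    by apply/andP; split; apply/andP; split; lra.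
  by split; apply/andP; split; lra.
have cA : compact A by apply: compact_setX; exact: segment_compact.
have A0 : A !=set0 by exists p0; apply/AP; rewrite dist_p0.
have [p /set_mem Ap pmin] := compact_EVT_min A0 cA
  (continuous_subspaceT continuous_neg_log_pl).
have pd : dist p <= 1 by exact/AP.
(* First-order condition in every direction whose unit-time segment stays in the square. *)
have dir u w : (forall t, 0 <= t <= 1 -> dist (p.1 + t * u, p.2 + t * w) <= 1) ->
    0 <= - (u * score1 p + w * score2 p).
  move=> H; apply: (derive_ge0_at_min (is_derive_neg_log_pl p u w)) => t t01.
  by rewrite !mul0r !addr0 -surjective_pairing; apply: pmin; apply/mem_set/AP/H.
have pr : dist p <= rho.
  apply: dist_bound => //.
  have := dir (p0.1 - p.1) (p0.2 - p.2).
  have -> : - ((p0.1 - p.1) * score1 p + (p0.2 - p.2) * score2 p) =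
    (p.1 - p0.1) * score1 p + (p.2 - p0.2) * score2 p by ring.
  apply=> t /andP[t0 t1]; rewrite /dist/=.
  have -> : p.1 + t * (p0.1 - p.1) - p0.1 = (1 - t) * (p.1 - p0.1) by ring.
  have -> : p.2 + t * (p0.2 - p.2) - p0.2 = (1 - t) * (p.2 - p0.2) by ring.
  have t1' : 0 <= 1 - t <= 1 by apply/andP; split; lra.
  move: pd; rewrite /dist !ge_max !normrM (ger0_norm (andP t1').1).
  move=> /andP[p1 p2]; move: t1' => /andP[? ?].
  by apply/andP; split; rewrite mulr_ile1.
(* The slack [1 - rho] makes all short directions admissible, in particular opposite ones. *)
have interior u w : `|u| <= 1 - rho -> `|w| <= 1 - rho ->
    0 <= - (u * score1 p + w * score2 p).
  move=> u1 w1; apply: dir => t /andP[t0 t1].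
  move: pr; rewrite /dist/= !ge_max => /andP[p1 p2].
  apply/andP; split; rewrite addrAC (le_trans (ler_normD _ _))//
    normrM (ger0_norm t0).
    have : t * `|u| <= `|u| by rewrite ler_piMl.
    by lra.
  have : t * `|w| <= `|w| by rewrite ler_piMl.
  by lra.
have c0 : 0 < 1 - rho by lra.
have nc : `|1 - rho| <= 1 - rho by rewrite gtr0_norm.
have nNc : `|- (1 - rho)| <= 1 - rho by rewrite normrN.
have n0 : `|0 : R| <= 1 - rho by rewrite normr0 ltW.
have Z y : 0 <= - ((1 - rho) * y) -> 0 <= - (- (1 - rho) * y) -> y = 0.
  move=> h1 h2; have : (1 - rho) * y = 0 by lra.
  by move/eqP; rewrite mulf_eq0 gt_eqF//= => /eqP.
exists p; split => //; apply: Z.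
- by have := interior _ _ nc n0; rewrite mul0r addr0.
- by have := interior _ _ nNc n0; rewrite mul0r addr0.
- by have := interior _ _ n0 nc; rewrite mul0r add0r.
- by have := interior _ _ n0 nNc; rewrite mul0r add0r.
Qed.

End PseudoLikelihood.

(** * Sensitivity of the local fields to one coordinate *)

Section LocalFields.
Context (R : realType) (N : nat) (A : tensor3 R N).
Hypothesis adA : admissible A.
Local Notation config := (N.-tuple (measurableTypeR R)).
Implicit Types y : config.

Lemma tensor_diag i j k : [|| i == j, j == k | i == k] -> A i j k = 0.
Proof.
have [_ _ _ A0] := adA; move=> H; apply: A0.
by move: H; rewrite -negb_or -negb_or negbK.
Qed.

(** Every term of the local field at [i] that involves coordinate [i] sits on a diagonal of [A]. *)
Lemma local_field_upd y i z :
  local_field A (tuple_upd y i z) i = local_field A y i.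
Proof.
apply: eq_bigr => j _; apply: eq_bigr => k _; rewrite !tnth_mktuple.
have [->|ji] := eqVneq j i; first by rewrite tensor_diag ?eqxx// !mul0r.
have [->|//] := eqVneq k i.
by rewrite (@tensor_diag i j i) ?eqxx ?orbT// !mul0r.
Qed.

(* The Hamiltonian is affine in each coordinate because A vanishes on the
   diagonals; the slope is the local field. *)
Lemma hamiltonian_upd beta h y i z :
  hamiltonian A beta h (tuple_upd y i z) =
  hamiltonian A beta h (tuple_upd y i 0) + z * (beta * local_field A y i + h).
Proof.
have [_ A12 A23 _] := adA.
set y0 := tuple_upd y i 0.
have E j : tnth (tuple_upd y i z) j = tnth y0 j + z * (j == i)%:R.
  rewrite !tnth_mktuple; case: (j == i); first by rewrite add0r mulr1.
  by rewrite mulr0 addr0.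
pose d (j : 'I_N) : R := (j == i)%:R.
(* Two slots of the tensor cannot both equal [i], so the terms of degree 2 and 3 in [z] vanish. *)
have dd a b c : A a b c * d a * d b = 0.
  rewrite /d; have [->|ne] := eqVneq a i; last by rewrite mulr0 mul0r.
  have [->|_] := eqVneq b i; last by rewrite mulr0.
  by rewrite tensor_diag ?eqxx// !mul0r.
have dd2 a b c : A a b c * d a * d c = 0 by rewrite A23 dd.
have dd3 a b c : A a b c * d b * d c = 0 by rewrite A12 dd2.
have S3 : \sum_a \sum_b \sum_c A a b c * (tnth y0 a + z * d a) *
      (tnth y0 b + z * d b) * (tnth y0 c + z * d c) =
    \sum_a \sum_b \sum_c A a b c * tnth y0 a * tnth y0 b * tnth y0 c +
    z * (\sum_a \sum_b \sum_c d a * (A a b c * tnth y0 b * tnth y0 c) +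
         \sum_a \sum_b \sum_c d b * (A a b c * tnth y0 a * tnth y0 c) +
         \sum_a \sum_b \sum_c d c * (A a b c * tnth y0 a * tnth y0 b)).
  rewrite !mulrDr !mulr_sumr -!big_split; apply: eq_bigr => a _ /=.
  rewrite !mulr_sumr -!big_split; apply: eq_bigr => b _ /=.
  rewrite !mulr_sumr -!big_split; apply: eq_bigr => c _ /=.
  have -> : A a b c * (tnth y0 a + z * d a) *
      (tnth y0 b + z * d b) * (tnth y0 c + z * d c) =
    A a b c * tnth y0 a * tnth y0 b * tnth y0 c +
    (z * (d a * (A a b c * tnth y0 b * tnth y0 c)) +
     z * (d b * (A a b c * tnth y0 a * tnth y0 c)) +
     z * (d c * (A a b c * tnth y0 a * tnth y0 b))) +
    (A a b c * d a * d b * z ^+ 2 * (tnth y0 c + z * d c) +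
     A a b c * d a * d c * z ^+ 2 * tnth y0 b +
     A a b c * d b * d c * z ^+ 2 * tnth y0 a) by ring.
  by rewrite dd dd2 dd3 !mul0r !addr0.
have pick (F : 'I_N -> R) : \sum_a d a * F a = F i.
  rewrite (bigD1 i)//= {1}/d eqxx mul1r big1 ?addr0// => a ai.
  by rewrite /d (negbTE ai) mul0r.
have lf : local_field A y0 i = local_field A y i by exact: local_field_upd.
have P1 : \sum_a \sum_b \sum_c d a * (A a b c * tnth y0 b * tnth y0 c) =
    local_field A y i.
  under eq_bigr => a _ do
    (under eq_bigr => b _ do rewrite -mulr_sumr; rewrite -mulr_sumr).
  by rewrite pick -lf.
(* By symmetry each of the three slots contributes the same local field, which cancels the 3 in
   [beta / 3]. *)
have P2 : \sum_a \sum_b \sum_c d b * (A a b c * tnth y0 a * tnth y0 c) =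
    local_field A y i.
  rewrite exchange_big/= -P1; apply: eq_bigr => a _; apply: eq_bigr => b _.
  by apply: eq_bigr => c _; rewrite A12.
have P3 : \sum_a \sum_b \sum_c d c * (A a b c * tnth y0 a * tnth y0 b) =
    local_field A y i.
  rewrite -P2; apply: eq_bigr => a _; rewrite exchange_big/=.
  by apply: eq_bigr => b _; apply: eq_bigr => c _; rewrite A23.
rewrite /hamiltonian.
have -> : \sum_a \sum_b \sum_c A a b c * tnth (tuple_upd y i z) a *
      tnth (tuple_upd y i z) b * tnth (tuple_upd y i z) c =
    \sum_a \sum_b \sum_c A a b c * (tnth y0 a + z * d a) *
      (tnth y0 b + z * d b) * (tnth y0 c + z * d c).
  by apply: eq_bigr => a _; apply: eq_bigr => b _; apply: eq_bigr => c _; rewrite !E.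
rewrite S3 P1 P2 P3.
have -> : \sum_j tnth (tuple_upd y i z) j = \sum_j tnth y0 j + z.
  under eq_bigr do rewrite E; rewrite big_split/=; congr (_ + _).
  by rewrite -mulr_sumr -[RHS]mulr1; congr (_ * _); rewrite -[RHS](pick (fun=> 1));
    apply: eq_bigr => j _; rewrite mulr1.
by field.
Qed.

Variables (K gamma : R).
Hypothesis K0 : 0 <= K.
Hypothesis Agamma : forall i, \sum_j \sum_k A i j k <= gamma.

Lemma local_field_le y i : (forall j, `|tnth y j| <= K) ->
  `|local_field A y i| <= gamma * K ^+ 2.
Proof.
have [A0 _ _ _] := adA; move=> yK; rewrite /local_field.
apply: (@le_trans _ _ (\sum_j \sum_k A i j k * K ^+ 2)).
  rewrite (le_trans (ler_norm_sum _ _ _))//; apply: ler_sum => j _.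
  rewrite (le_trans (ler_norm_sum _ _ _))//; apply: ler_sum => k _.
  rewrite !normrM (ger0_norm (A0 _ _ _)) -mulrA ler_wpM2l// expr2.
  by rewrite ler_pM.
under eq_bigr do rewrite -mulr_suml; rewrite -mulr_suml.
by rewrite ler_wpM2r ?sqr_ge0.
Qed.

(** Zeroing coordinate [i] deletes exactly the terms with [i] in one of the two free slots, each of
    size at most K^2 times its tensor entry. The two slots give the factor 2. *)
Lemma local_field_upd_le y i j : (forall k, `|tnth y k| <= K) ->
  `|local_field A y j - local_field A (tuple_upd y i 0) j| <=
  2 * K ^+ 2 * \sum_k A j i k.
Proof.
have [A0 A12 A23 _] := adA; move=> yK; rewrite /local_field.
pose d (j : 'I_N) : R := (j == i)%:R.
have pick (F : 'I_N -> R) : \sum_a d a * F a = F i.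
  rewrite (bigD1 i)//= {1}/d eqxx mul1r big1 ?addr0// => a ai.
  by rewrite /d (negbTE ai) mul0r.
apply: (@le_trans _ _ (\sum_a \sum_b
    (d a * (K ^+ 2 * A j a b) + d b * (K ^+ 2 * A j a b)))).
  rewrite -sumrB (le_trans (ler_norm_sum _ _ _))//; apply: ler_sum => a _.
  rewrite -sumrB (le_trans (ler_norm_sum _ _ _))//; apply: ler_sum => b _.
  rewrite !tnth_mktuple /d.
  have T : `|A j a b * tnth y a * tnth y b| <= K ^+ 2 * A j a b.
    by rewrite -mulrA mulrC !normrM (ger0_norm (A0 _ _ _)) ler_wpM2r// expr2 ler_pM.
  have T0 : 0 <= K ^+ 2 * A j a b by rewrite mulr_ge0// sqr_ge0.
  case: (a == i); case: (b == i);
    rewrite ?mulr0 ?mul0r ?mul1r ?addr0 ?add0r ?subr0 ?subrr ?normr0//.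
  by rewrite (le_trans T)// lerDl.
have -> : \sum_a \sum_b (d a * (K ^+ 2 * A j a b) + d b * (K ^+ 2 * A j a b)) =
    K ^+ 2 * (\sum_k A j i k) + K ^+ 2 * (\sum_k A j i k).
  under eq_bigr do rewrite big_split/=.
  rewrite big_split/=; congr (_ + _).
    by under eq_bigr do rewrite -mulr_sumr; rewrite pick mulr_sumr.
  rewrite exchange_big/=; under eq_bigr do rewrite -mulr_sumr; rewrite pick.
  by rewrite mulr_sumr; apply: eq_bigr => a _; rewrite A23.
by rewrite le_eqVlt; apply/orP; left; apply/eqP; ring.
Qed.

Section ScoreTerm.
Variables (L1 : R -> R) (b0 h0 a b Lip : R).
Hypothesis L1K : forall t, `|L1 t| <= K.
Hypothesis L1Lip : forall s t, `|L1 t - L1 s| <= Lip * `|t - s|.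

(* The summands of the two pseudo-likelihood scores are the cases (a, b) = (1, 0)
   and (a, b) = (0, 1). *)
Definition score_term y i : R := (a * local_field A y i + b) *
  (tnth y i - L1 (b0 * local_field A y i + h0)).

Let wK := `|a| * (gamma * K ^+ 2) + `|b|.

Let weight_le y i : (forall j, `|tnth y j| <= K) ->
  `|a * local_field A y i + b| <= wK.
Proof.
move=> yK; rewrite (le_trans (ler_normD _ _))// lerD2r normrM ler_wpM2l//.
exact: local_field_le.
Qed.

Let resid_le y i t : (forall j, `|tnth y j| <= K) -> `|tnth y i - L1 t| <= 2 * K.
Proof. by move=> yK; rewrite (le_trans (ler_normB _ _))// mulrDl mul1r lerD. Qed.

Definition score_term_bound : R := wK * (2 * K).

Lemma score_term_le y i : (forall j, `|tnth y j| <= K) ->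
  `|score_term y i| <= score_term_bound.
Proof. by move=> yK; rewrite normrM ler_pM ?weight_le ?resid_le. Qed.

Definition score_term_influence : R :=
  (`|a| * (2 * K) + wK * (Lip * `|b0|)) * (2 * K ^+ 2).

Lemma score_term_upd_le y i j : i != j -> (forall k, `|tnth y k| <= K) ->
  `|score_term y j - score_term (tuple_upd y i 0) j| <=
  score_term_influence * \sum_k A j i k.
Proof.
move=> ij yK; have dm := local_field_upd_le i j yK.
have y'K k : `|tnth (tuple_upd y i 0) k| <= K.
  by rewrite tnth_mktuple; case: ifP => _ //; rewrite normr0.
have tj : tnth (tuple_upd y i 0) j = tnth y j.
  by rewrite tnth_mktuple eq_sym (negbTE ij).
rewrite /score_term tj.
have w'K := weight_le j y'K.
set m := local_field A y j in dm *; set m' := local_field A _ j in dm w'K *.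
(* Product rule for differences: the weight changes first, then the residual, in which [tnth y j] is
   unaffected because [i != j]. *)
have -> : (a * m + b) * (tnth y j - L1 (b0 * m + h0)) -
    (a * m' + b) * (tnth y j - L1 (b0 * m' + h0)) =
    a * (m - m') * (tnth y j - L1 (b0 * m + h0)) -
    (a * m' + b) * (L1 (b0 * m + h0) - L1 (b0 * m' + h0)) by ring.
rewrite (le_trans (ler_normB _ _))//.
apply: (@le_trans _ _ ((`|a| * (2 * K) + wK * (Lip * `|b0|)) * `|m - m'|)).
  rewrite [leRHS]mulrDl; apply: lerD.
    by rewrite !normrM mulrAC ler_wpM2r// ler_wpM2l// resid_le.
  rewrite normrM -mulrA ler_pM// (le_trans (L1Lip _ _))//.
  by rewrite opprD addrACA subrr addr0 -mulrBr normrM mulrA.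
rewrite /score_term_influence -mulrA ler_wpM2l//.
have Lip0 : 0 <= Lip.
  by have := L1Lip 0 1; rewrite subr0 normr1 mulr1; exact: le_trans.
by rewrite addr_ge0// mulr_ge0// ?mulr_ge0// (le_trans _ w'K).
Qed.

End ScoreTerm.
End LocalFields.

(** * Second moments of the scores under the Gibbs measure *)

Section Clamp.
Context (R : realType) (km kp : R) (mu : probability (measurableTypeR R) R).
Hypothesis Hk : km < kp.
Hypothesis Hmu : mu `[km, kp]%classic = 1%E.

Definition clamp (z : measurableTypeR R) : R := Num.max km (Num.min kp z).

Lemma clamp_id z : `[km, kp]%classic z -> clamp z = z.
Proof. by rewrite /= in_itv/= => /andP[kz zk]; rewrite /clamp min_r// max_r. Qed.

Lemma clamp_ge z : km <= clamp z. Proof. by rewrite le_max lexx. Qed.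

Lemma clamp_le z : clamp z <= kp.
Proof. by rewrite ge_max (ltW Hk) ge_min lexx. Qed.

Definition clamp_bound : R := `|km| + `|kp|.

Lemma normr_clamp z : `|clamp z| <= clamp_bound.
Proof.
have := clamp_ge z; have := clamp_le z; rewrite /clamp_bound ler_norml.
have := ler_norm km; have := ler_norm kp.
have := lerNnormlW (lexx `|km|); have := lerNnormlW (lexx `|kp|).
have := normr_ge0 km; have := normr_ge0 kp.
by move=> *; apply/andP; split; lra.
Qed.

Lemma measurable_clamp : measurable_fun setT clamp.
Proof.
apply: (@measurable_maxr _ _ _ _ (cst km)) => //.
by apply: (@measurable_minr _ _ _ _ (cst kp)) => //; exact: measurable_id.
Qed.

Lemma bmf_clamp : bmfun clamp.
Proof. by split; [exact: measurable_clamp | exists clamp_bound; exact: normr_clamp]. Qed.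

(** [mu] charges only [[km, kp]], so the results on tilts of bounded functions apply to the
    log-Laplace transform. *)
Lemma log_laplaceE : log_laplace mu = fun t => ln (tilt mu clamp (fun=> 1) t).
Proof.
apply/funext => t; rewrite /log_laplace/tilt; congr ln; apply/esym.
apply: (@Rintegral_ae _ _ _ mu _ _ `[km, kp]%classic) => //.
- apply: bmfM; first exact: bmf_cst.
  apply: (@bmf_continuous _ _ _ expR); first exact: continuous_expR.
  by apply: bmfM; [exact: bmf_cst | exact: bmf_clamp].
- apply: measurableT_comp => //; apply: measurable_funM => //.
- by move=> z kz; rewrite clamp_id// mul1r.
Qed.

Lemma is_derive_log_laplace (t : R) :
  is_derive t 1 (log_laplace mu) (cgf1 mu clamp t).
Proof.
rewrite log_laplaceE; exact: (is_derive_cgf mu measurable_clamp normr_clamp).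
Qed.

Lemma derive1_log_laplace : derive1 (log_laplace mu) = cgf1 mu clamp.
Proof.
apply/funext => t; rewrite derive1E.
exact: (@derive_val _ _ _ _ _ _ _ (is_derive_log_laplace t)).
Qed.

Hypothesis Hkm : measure_support mu km.
Hypothesis Hkp : measure_support mu kp.

(* Any [a] is at distance at least a quarter of [kp - km] from one of two
   neighbourhoods of the end points, both of which have positive mass. *)
Lemma clamp_nondegenerate :
  exists2 v, 0 < v & forall a, v <= \int[mu]_z (clamp z - a) ^+ 2.
Proof.
pose e := (kp - km) / 4.
have e0 : 0 < e by rewrite divr_gt0 ?subr_gt0.
pose U := [set z : R | z < km + e]; pose V := [set z : R | kp - e < z].
have oU : open U by exact: open_lt.
have oV : open V by exact: open_gt.
have mU : measurable (U : set (measurableTypeR R)) by exact: open_measurable.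
have mV : measurable (V : set (measurableTypeR R)) by exact: open_measurable.
have pos (W : set (measurableTypeR R)) : measurable W -> (0 < mu W)%E -> 0 < fine (mu W).
  move=> mW W0; apply: fine_gt0; rewrite W0/=.
  by rewrite (le_lt_trans (probability_le1 mu mW))// ltry.
have U0 : 0 < fine (mu U) by apply: pos => //; apply: Hkm => //; rewrite /U/= ltrDl.
have V0 : 0 < fine (mu V) by apply: pos => //; apply: Hkp => //;
  rewrite /V/= ltrBlDr ltrDl.
have bsq a : bmfun (fun z => (clamp z - a) ^+ 2).
  by apply: bmfX; apply: bmfB; [exact: bmf_clamp | exact: bmf_cst].
have key a (W : set (measurableTypeR R)) : measurable W ->
    (forall z, W z -> e ^+ 2 <= (clamp z - a) ^+ 2) ->
    e ^+ 2 * fine (mu W) <= \int[mu]_z (clamp z - a) ^+ 2.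
  move=> mW WE; rewrite -Rintegral_indic// -bmf_RintegralZ; last exact: bmf_indic.
  apply: bmf_le_Rintegral => //.
    by apply: bmfM; [exact: bmf_cst | exact: bmf_indic].
  move=> z; rewrite indicE; have [zW|_] := boolP (z \in W).
    by rewrite mulr1; apply/WE/set_mem.
  by rewrite mulr0 sqr_ge0.
exists (e ^+ 2 * Num.min (fine (mu U)) (fine (mu V))).
  by rewrite mulr_gt0 ?exprn_gt0// lt_min U0 V0.
move=> a; have [am|am] := leP a ((km + kp) / 2).
  apply: (@le_trans _ _ (e ^+ 2 * fine (mu V))).
    by rewrite ler_wpM2l ?sqr_ge0// ge_min lexx orbT.
  apply: key => // z; rewrite /V/= => zV.
  have cz : kp - e <= clamp z.
    by rewrite /clamp le_max le_min (ltW zV) andbT; apply/orP; right; lra.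
  have ca : e <= clamp z - a by rewrite /e in cz *; lra.
  by rewrite lerXn2r ?nnegrE// ?(ltW e0)// (le_trans (ltW e0) ca).
apply: (@le_trans _ _ (e ^+ 2 * fine (mu U))).
  by rewrite ler_wpM2l ?sqr_ge0// ge_min lexx.
apply: key => // z; rewrite /U/= => zU.
have cz : clamp z <= km + e.
  by rewrite /clamp ge_max ge_min (ltW zU) orbT andbT; lra.
have ca : e <= a - clamp z by rewrite /e in cz *; lra.
rewrite -[leRHS]sqrrN opprB.
by rewrite lerXn2r ?nnegrE// ?(ltW e0)// (le_trans (ltW e0) ca).
Qed.

End Clamp.

(** * Conditional centring and second moments under the Gibbs measure *)

Section GibbsMoments.
Context (R : realType) (km kp : R) (mu : probability (measurableTypeR R) R).
Hypothesis Hk : km < kp.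
Hypothesis Hmu : mu `[km, kp]%classic = 1%E.
Context (N : nat) (A : tensor3 R N) (b0 h0 gamma : R).
Hypothesis adA : admissible A.
Hypothesis Agamma : forall i, \sum_j \sum_k A i j k <= gamma.
Local Notation config := (N.-tuple (measurableTypeR R)).
Local Notation muN := (product_power mu N).
Local Notation K := (clamp_bound km kp).
Local Notation L1 := (cgf1 mu (clamp km kp)).

Definition clampt (x : config) : config := [tuple clamp km kp (tnth x i) | i < N].

Let cK x i : `|tnth (clampt x) i| <= K.
Proof. by rewrite tnth_mktuple normr_clamp. Qed.

Definition box : set config := [set x | forall i, `[km, kp]%classic (tnth x i)].

Lemma clampt_id x : box x -> clampt x = x.
Proof.
by move=> bx; apply: eq_from_tnth => i; rewrite tnth_mktuple clamp_id//; exact: bx.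
Qed.

Lemma measurable_box : measurable box.
Proof.
rewrite (_ : box = \bigcap_(i in [set: 'I_N])
    ((fun x : config => tnth x i) @^-1` `[km, kp]%classic)).
  apply: fin_bigcap_measurable => // i _; rewrite -[X in measurable X]setTI.
  by apply: measurable_tnth => //; exact: measurable_itv.
by apply/seteqP; split => [x Bx i _|x Bx i]; exact: Bx.
Qed.

Lemma product_power_box : muN box = 1%E.
Proof.
rewrite /box (product_power_rect mu (A := fun=> `[km, kp]%classic))//.
by rewrite big1.
Qed.

Section CoordinateFunctions.
Context d (T : measurableType d) (y : T -> config).
Hypothesis bmf_y : forall i, bmfun (fun x => tnth (y x) i : R).

(** The map [y] is arbitrary in order to cover clamped configurations and those with one coordinate
    then set to zero. *)
Lemma bmf_local_field i : bmfun (fun x => local_field A (y x) i).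
Proof.
apply: bmf_sum => j; apply: bmf_sum => k.
by apply: bmfM => //; apply: bmfM => //; exact: bmf_cst.
Qed.

Lemma bmf_score_term a b i : bmfun (fun x => score_term A L1 b0 h0 a b (y x) i).
Proof.
have bl := bmf_local_field i.
have bc (c : R) : bmfun (fun _ : T => c) by exact: bmf_cst.
apply: bmfM; first by apply: bmfD => //; exact: bmfM.
apply: bmfB => //.
apply: (@bmf_continuous _ _ _ L1 (fun x => b0 * local_field A (y x) i + h0)).
  exact: continuous_cgf1 (measurable_clamp km kp) (normr_clamp Hk).
by apply: bmfD => //; exact: bmfM.
Qed.

Lemma bmf_hamiltonian : bmfun (fun x => hamiltonian A b0 h0 (y x)).
Proof.
have bc (c : R) : bmfun (fun _ : T => c) by exact: bmf_cst.
apply: bmfD; apply: bmfM => //; apply: bmf_sum => // j; apply: bmf_sum => k.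
apply: bmf_sum => l.
by apply: bmfM => //; apply: bmfM => //; exact: bmfM.
Qed.

Lemma bmf_exp_hamiltonian : bmfun (fun x => expR (hamiltonian A b0 h0 (y x))).
Proof.
exact: (@bmf_continuous _ _ _ expR _ (@continuous_expR _) bmf_hamiltonian).
Qed.

End CoordinateFunctions.

Lemma bmf_clampt i : bmfun (fun x : config => tnth (clampt x) i : R).
Proof.
under eq_fun do rewrite tnth_mktuple.
exact: bmf_comp (measurable_tnth i) (bmf_clamp Hk).
Qed.

Let bmf_clampt_upd i j : bmfun (fun x : config => tnth (tuple_upd (clampt x) i 0) j : R).
Proof.
under eq_fun do rewrite tnth_mktuple.
by case: (j == i); [exact: bmf_cst | exact: bmf_clampt].
Qed.

Let W x := expR (hamiltonian A b0 h0 (clampt x)).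
Let bW : bmfun W. Proof. exact: bmf_exp_hamiltonian bmf_clampt. Qed.

Lemma clampt_upd x i z :
  clampt (tuple_upd x i z) = tuple_upd (clampt x) i (clamp km kp z).
Proof.
by apply: eq_from_tnth => j; rewrite !tnth_mktuple; case: ifP.
Qed.

Lemma tuple_upd_upd (x : config) i z w :
  tuple_upd (tuple_upd x i z) i w = tuple_upd x i w.
Proof.
by apply: eq_from_tnth => j; rewrite !tnth_mktuple; case: ifP => // ->.
Qed.

(* The conditional law of [x_i] given the other coordinates is the tilt of [mu]
   by [b0 * m_i + h0], whose mean is [L1 (b0 * m_i + h0)]. *)
Lemma score_term_orthogonal a b i (g : config -> R) :
  bmfun (fun x => g (tuple_upd (clampt x) i 0)) ->
  \int[muN]_x (score_term A L1 b0 h0 a b (clampt x) i *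
    g (tuple_upd (clampt x) i 0) * W x) = 0.
Proof.
move=> bg; apply: (@product_power_resample _ _ _ mu N _ i).
  by apply: bmfM => //; apply: bmfM => //; exact: (bmf_score_term bmf_clampt).
move=> x; set y := clampt x; set t := b0 * local_field A y i + h0.
(* [C] collects all factors that are free of the resampled coordinate. *)
pose C := (a * local_field A y i + b) * g (tuple_upd y i 0) *
  expR (hamiltonian A b0 h0 (tuple_upd y i 0)).
have bt : bmfun (fun z => (clamp km kp z - L1 t) * expR (t * clamp km kp z)).
  apply: bmfM; first by apply: bmfB; [exact: bmf_clamp | exact: bmf_cst].
  apply: (@bmf_continuous _ _ _ expR); first exact: continuous_expR.
  by apply: bmfM; [exact: bmf_cst | exact: bmf_clamp].
transitivity (\int[mu]_z (C * ((clamp km kp z - L1 t) * expR (t * clamp km kp z)))).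
  apply: eq_Rintegral => z _.
  rewrite /W clampt_upd -/y tuple_upd_upd /score_term local_field_upd// -/t.
  rewrite hamiltonian_upd// -/t expRD [_ * t]mulrC tnth_mktuple eqxx /C.
  by ring.
rewrite bmf_RintegralZ//.
have := tilt_centered mu (measurable_clamp km kp) (normr_clamp Hk) t.
by rewrite /tilt => ->; rewrite mulr0.
Qed.

Let Lip := (2 * K) ^+ 2.

Let L1Lip s t : `|L1 t - L1 s| <= Lip * `|t - s|.
Proof. exact: cgf1_lipschitz (measurable_clamp km kp) (normr_clamp Hk) s t. Qed.

Let L1K t : `|L1 t| <= K.
Proof. exact: cgf1_le (measurable_clamp km kp) (normr_clamp Hk) t. Qed.

Let K0 : 0 <= K. Proof. by rewrite addr_ge0. Qed.

(** Cost per site: the diagonal term plus the total influence of the other coordinates, summed by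
    the row bound [gamma]. *)
Definition second_moment_bound a b : R :=
  score_term_bound K gamma a b *
  (score_term_bound K gamma a b + score_term_influence K gamma b0 a b Lip * gamma).

Lemma score_second_moment a b :
  \int[muN]_x ((\sum_i score_term A L1 b0 h0 a b (clampt x) i) ^+ 2 * W x) <=
  N%:R * second_moment_bound a b * \int[muN]_x W x.
Proof.
set u := score_term A L1 b0 h0 a b.
set C0 := score_term_bound K gamma a b.
set C1 := score_term_influence K gamma b0 a b Lip.
have bu i : bmfun (fun x => u (clampt x) i) by exact: (bmf_score_term bmf_clampt).
have bu' i j : bmfun (fun x => u (tuple_upd (clampt x) i 0) j).
  exact: (bmf_score_term (bmf_clampt_upd i)).
have uC x i : `|u (clampt x) i| <= C0 by apply: score_term_le.
have [A0 A12 A23 _] := adA.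
(* The decoupled off-diagonal product: its second factor no longer sees coordinate [i], so it
   integrates to zero by [score_term_orthogonal]. *)
pose G i j x := if i == j then 0 else
  u (clampt x) i * u (tuple_upd (clampt x) i 0) j * W x.
have bG i j : bmfun (G i j).
  rewrite /G; case: (i == j); first exact: bmf_cst.
  by apply: bmfM => //; exact: bmfM.
have G0 i j : \int[muN]_x G i j x = 0.
  rewrite /G; case: (i == j); first by rewrite Rintegral_cst// mul0r.
  exact: (@score_term_orthogonal a b i (fun y => u y j)).
have upd_le x i j : i != j ->
    `|u (clampt x) j - u (tuple_upd (clampt x) i 0) j| <= C1 * \sum_k A j i k.
  by move=> ij; apply: score_term_upd_le.
(* Price of a pair: the full square on the diagonal, and the decoupling error off it. *)
pose c i j := C0 * ((i == j)%:R * C0 + C1 * \sum_k A j i k).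
have pt x i j : u (clampt x) i * u (clampt x) j * W x <= G i j x + c i j * W x.
  have C00 : 0 <= C0 by rewrite (le_trans _ (uC x i)).
  have C10 : 0 <= C1 * \sum_k A j i k.
    have [<-|ij] := eqVneq i j.
      by rewrite big1 ?mulr0// => k _; rewrite tensor_diag// eqxx.
    by rewrite (le_trans _ (upd_le x i j ij)).
  rewrite /G /c; have [ij|ij] := eqVneq i j.
    rewrite ij in C10 *.
    rewrite add0r mul1r ler_wpM2r ?expR_ge0//.
    apply: (@le_trans _ _ (C0 * C0)); last by rewrite ler_wpM2l// lerDl.
    by rewrite (le_trans (ler_norm _))// normrM ler_pM.
  rewrite mul0r add0r -lerBlDl -mulrBl ler_wpM2r ?expR_ge0// -mulrBr.
  rewrite (le_trans (ler_norm _))// normrM ler_pM//.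
  exact: upd_le.
have bcW i j : bmfun (fun x => c i j * W x) by apply: bmfM => //; exact: bmf_cst.
have bS : bmfun (fun x => \sum_i \sum_j (G i j x + c i j * W x)).
  by apply: bmf_sum => i; apply: bmf_sum => j; exact: bmfD.
apply: (@le_trans _ _ (\int[muN]_x (\sum_i \sum_j (G i j x + c i j * W x)))).
  apply: bmf_le_Rintegral => //.
    by apply: bmfM => //; apply: bmfX; exact: bmf_sum.
  move=> x; rewrite expr2 mulr_suml mulr_suml; apply: ler_sum => i _.
  by rewrite mulr_sumr mulr_suml; apply: ler_sum => j _.
rewrite bmf_Rintegral_sum; last by move=> i; apply: bmf_sum => j; exact: bmfD.
have -> : \sum_i \int[muN]_x (\sum_j (G i j x + c i j * W x)) =
    (\sum_i \sum_j c i j) * \int[muN]_x W x.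
  rewrite mulr_suml; apply: eq_bigr => i _.
  rewrite bmf_Rintegral_sum; last by move=> j; exact: bmfD.
  rewrite mulr_suml; apply: eq_bigr => j _.
  by rewrite bmf_RintegralD// G0 add0r bmf_RintegralZ.
apply: ler_wpM2r; first by apply: Rintegral_ge0 => x _; exact: expR_ge0.
(* With [j] outside, the sum over [i] and [k] of [A j i k] is exactly the quantity bounded by
   [gamma]. *)
rewrite exchange_big/= mulr_natl -[X in _ *+ X](card_ord N) -sumr_const.
apply: ler_sum => j _.
have C00 : 0 <= C0.
  by rewrite /C0 /score_term_bound !mulr_ge0// addr_ge0// !mulr_ge0// ?sqr_ge0//
    (le_trans _ (Agamma j))// sumr_ge0// => k _; rewrite sumr_ge0.
rewrite /second_moment_bound -/C0 -/C1 /c -mulr_sumr ler_wpM2l//.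
rewrite big_split/= lerD//.
  rewrite (bigD1 j)//= eqxx mul1r big1 ?addr0// => i /negbTE ij.
  by rewrite ij mul0r.
rewrite -mulr_sumr ler_wpM2l//.
have gamma0 : 0 <= gamma.
  by rewrite (le_trans _ (Agamma j))// sumr_ge0// => k _; rewrite sumr_ge0.
rewrite /C1 /score_term_influence mulr_ge0 ?(mulr_ge0 _ (sqr_ge0 _))//.
by rewrite addr_ge0 ?mulr_ge0// ?addr_ge0 ?mulr_ge0 ?sqr_ge0.
Qed.

Local Notation Z := (partition_function mu A b0 h0).
Local Notation P := (gibbs mu A b0 h0).

Let mW0 : measurable_fun setT (fun x : config => expR (hamiltonian A b0 h0 x)).
Proof. by apply: measurableT_comp => //; exact: measurable_hamiltonian. Qed.

Lemma partition_functionE : Z = \int[muN]_x W x.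
Proof.
apply/esym; apply: (@Rintegral_ae _ _ _ muN _ _ box) => //.
- exact: measurable_box.
- exact: product_power_box.
- by move=> x bx; rewrite /W clampt_id.
Qed.

Lemma partition_function_gt0 : 0 < Z.
Proof.
have [_ [C hC]] := bmf_hamiltonian bmf_clampt.
rewrite partition_functionE (lt_le_trans (expR_gt0 (- C)))//.
have -> : expR (- C) = \int[muN]_x expR (- C).
  have nu1 : fine (muN [set: config]) = 1 by rewrite probability_setT.
  by rewrite -[LHS]mulr1 -[X in _ * X = _]nu1 -Rintegral_cst.
apply: bmf_le_Rintegral => //; first exact: bmf_cst.
by move=> x; rewrite ler_expR; have := hC x; rewrite ler_norml => /andP[].
Qed.

Let bE E : measurable E -> bmfun (fun x => \1_E x * (W x / Z)).
Proof.
by move=> mE; apply: bmfM; [exact: bmf_indic|apply: bmfM => //; exact: bmf_cst].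
Qed.

(** With the clamped density, comparisons of probabilities become comparisons of integrals of
    bounded functions. *)
Lemma gibbsE E : measurable E -> P E = (\int[muN]_x (\1_E x * (W x / Z)))%:E.
Proof.
move=> mE; rewrite /gibbs integral_mkcond epatch_indic.
rewrite (@EFin_Rintegral_ae _ _ _ muN _
    (fun x => \1_E x * (expR (hamiltonian A b0 h0 x) / Z)) box).
- by apply: eq_integral => x _; rewrite /= -EFinM mulrC.
- exact: bE.
- by apply: measurable_funM; [exact: measurable_indic | exact: measurable_funM].
- exact: measurable_box.
- exact: product_power_box.
- by move=> x bx; rewrite /W clampt_id.
Qed.

Lemma gibbs_le1 E : measurable E -> (P E <= 1)%E.
Proof.
move=> mE; rewrite gibbsE// lee_fin.
have Z0 := partition_function_gt0.
have -> : 1 = \int[muN]_x (Z^-1 * W x).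
  by rewrite bmf_RintegralZ// -partition_functionE mulVf ?gt_eqF.
have bZ : bmfun (fun x => Z^-1 * W x) by apply: bmfM => //; exact: bmf_cst.
apply: bmf_le_Rintegral; [exact: bE | exact: bZ |] => x.
by rewrite [leRHS]mulrC ler_piMl// divr_ge0 ?expR_ge0// ltW.
Qed.

Let S a b x := \sum_i score_term A L1 b0 h0 a b (clampt x) i.

Let bS a b : bmfun (S a b).
Proof. by apply: bmf_sum => i; exact: (bmf_score_term bmf_clampt). Qed.

(** The scores are those of the clamped configuration; intersecting with [box] makes them the actual
    ones. *)
Definition score_event s : set config :=
  box `&` [set x | `|S 1 0 x| <= s] `&` [set x | `|S 0 1 x| <= s].

Lemma measurable_score_event s : measurable (score_event s).
Proof.
have mS a b : measurable [set x | `|S a b x| <= s].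
  have [mS _] := bS a b.
  rewrite (_ : [set x | _] = (fun x => `|S a b x|) @^-1` `]-oo, s]%classic).
    rewrite -[X in measurable X]setTI.
    have : measurable_fun setT (fun x => `|S a b x|) by exact: measurableT_comp.
    by apply => //; exact: measurable_itv.
  by apply/seteqP; split=> x /=; rewrite in_itv.
by apply: measurableI => //; apply: measurableI => //; exact: measurable_box.
Qed.

(** Chebyshev and union bounds in one pointwise inequality of densities. [G] will be an event on
    which the field variance is large. *)
Lemma gibbs_score_event G s : measurable G -> 0 < s ->
  (P G - (N%:R * (second_moment_bound 1 0 + second_moment_bound 0 1)
          / s ^+ 2)%:E <= P (G `&` score_event s))%E.
Proof.
move=> mG s0; have mS := measurable_score_event s.
have mGS : measurable (G `&` score_event s) by exact: measurableI.
have mB : measurable (~` box) by apply: measurableC; exact: measurable_box.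
have Z0 := partition_function_gt0.
have s20 : 0 < s ^+ 2 by rewrite exprn_gt0.
rewrite !gibbsE// -EFinB lee_fin.
pose V a b x := S a b x ^+ 2 * W x.
have bV a b : bmfun (V a b) by apply: bmfM => //; exact: bmfX.
(* With this normalisation [c * V a b x] is at least the density [W x / Z] wherever the score
   exceeds [s]. *)
pose c := (s ^+ 2 * Z)^-1.
have c0 : 0 <= c by rewrite invr_ge0 mulr_ge0// ltW.
have bcV a b : bmfun (fun x => c * V a b x) by apply: bmfM => //; exact: bmf_cst.
have B0 : \int[muN]_x (\1_(~` box) x * (W x / Z)) = 0.
  rewrite (@Rintegral_ae _ _ _ muN _ (fun=> 0) box).
  - by rewrite Rintegral_cst// mul0r.
  - exact: bE.
  - exact: measurable_cst.
  - exact: measurable_box.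
  - exact: product_power_box.
  - by move=> x bx; rewrite indicE memNset ?mul0r//; exact.
have IV a b : \int[muN]_x (c * V a b x) <= N%:R * second_moment_bound a b / s ^+ 2.
  rewrite bmf_RintegralZ// /c ler_pdivrMl ?mulr_gt0//.
  have -> : s ^+ 2 * Z * (N%:R * second_moment_bound a b / s ^+ 2) =
      N%:R * second_moment_bound a b * Z by field; rewrite ?gt_eqF.
  by rewrite partition_functionE; exact: score_second_moment.
apply: (@le_trans _ _ (\int[muN]_x (\1_G x * (W x / Z) - \1_(~` box) x * (W x / Z)
    - c * V 1 0 x - c * V 0 1 x))).
  rewrite !bmf_RintegralB//; [|exact: bE|exact: bE|..].
  - rewrite B0 subr0 mulrDr mulrDl.
    by have := IV 1 0; have := IV 0 1; lra.
  - by apply: bmfB; exact: bE.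
  - by apply: bmfB => //; apply: bmfB; exact: bE.
apply: bmf_le_Rintegral.
- by apply: bmfB => //; apply: bmfB => //; apply: bmfB; exact: bE.
- exact: bE.
move=> x.
have w0 : 0 <= W x / Z by rewrite divr_ge0 ?expR_ge0// ltW.
have V0 a b : 0 <= c * V a b x by rewrite mulr_ge0// mulr_ge0 ?sqr_ge0 ?expR_ge0.
have big a b : s < `|S a b x| -> W x / Z <= c * V a b x.
  move=> sS; rewrite /c /V invfM.
  have -> : (s ^+ 2)^-1 * Z^-1 * (S a b x ^+ 2 * W x) =
    (S a b x ^+ 2 / s ^+ 2) * (W x / Z) by ring.
  rewrite ler_peMl// ler_pdivlMr// mul1r -(real_normK (num_real (S a b x))).
  by rewrite lerXn2r ?nnegrE// ltW.
have := V0 1 0; have := V0 0 1; have := big 1 0; have := big 0 1.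
rewrite !indicE; move: w0; set w := W x / Z.
have i0 (b : bool) : 0 <= w -> 0 <= b%:R * w <= w.
  by case: b; rewrite ?mul1r ?mul0r => ->; rewrite lexx.
move=> w0 b1 b2 v1 v2.
have /andP[g0 g1] := i0 (x \in G) w0.
have /andP[n0 n1] := i0 (x \in ~` box) w0.
have /andP[f0 f1] := i0 (x \in G `&` score_event s) w0.
have [xG|xG] := boolP (x \in G); last by rewrite mul0r; lra.
have [xB|xB] := boolP (x \in ~` box); first by rewrite !mul1r; lra.
have bx : box x by apply: contrapT => nb; move/negP: xB; apply; apply/mem_set.
rewrite mul1r mul0r.
have [t1|/b2 t1] := leP `|S 1 0 x| s; last by lra.
have [t2|/b1 t2] := leP `|S 0 1 x| s; last by lra.
have -> : x \in G `&` score_event s.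
  by apply/mem_set; split; [exact: set_mem | split => //; split].
by rewrite mul1r; lra.
Qed.

(** The deterministic root analysis is applied with centre [(b0, h0)]; uniqueness then identifies
    the root found near the centre with [mple]. *)
Lemma score_event_mple v s x : 0 < v ->
  (forall a, v <= \int[mu]_z (clamp km kp z - a) ^+ 2) ->
  let D := gamma * K ^+ 2 in
  let eta := v * expR (- (2 * ((`|b0| + 1) * D + (`|h0| + 1)) * K))
    / (1 + 2 * D ^+ 2) in
  let rho := 2 * s / (eta * (N%:R * field_variance A x)) in
  (0 < N)%N -> 0 < field_variance A x -> score_event s x -> rho < 1 ->
  mple_exists mu A x /\
  Num.max `|(mple mu A x).1 - b0| `|(mple mu A x).2 - h0| <= rho.
Proof.
move=> v0 hv D eta rho N0 V0 [[bx s1] s2] rho1.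
have mc := measurable_clamp km kp; have nc := normr_clamp Hk.
pose m i := local_field A x i; pose xi i : R := tnth x i.
have mD i : `|m i| <= D.
  by apply: local_field_le => // j; rewrite -(clampt_id bx).
(* Choosing the radius according to the pair turns local strong monotonicity into global strict
   monotonicity. *)
have mono s' t : s' != t -> 0 < (t - s') * (L1 t - L1 s').
  move=> st; apply: lt_le_trans (cgf1_strong_monotone mc nc
    (B := Num.max `|s'| `|t|) hv (ltW v0) _ _); rewrite ?le_max ?lexx ?orbT//.
  apply: mulr_gt0; first by rewrite mulr_gt0 ?expR_gt0.
  by rewrite exprn_even_gt0//= subr_eq0 eq_sym.
have strong u t : `|u| <= (`|b0| + 1) * D + (`|h0| + 1) ->
    `|t| <= (`|b0| + 1) * D + (`|h0| + 1) ->
    v * expR (- (2 * ((`|b0| + 1) * D + (`|h0| + 1)) * K)) * (t - u) ^+ 2 <=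
    (t - u) * (L1 t - L1 u).
  exact: (cgf1_strong_monotone mc nc hv (ltW v0)).
have S1 : `|score1 m xi L1 (b0, h0)| <= s.
  have -> : score1 m xi L1 (b0, h0) = S 1 0 x; last exact: s1.
  rewrite /S clampt_id//; apply: eq_bigr => i _.
  by rewrite /score_term mul1r addr0.
have S2 : `|score2 m xi L1 (b0, h0)| <= s.
  have -> : score2 m xi L1 (b0, h0) = S 0 1 x; last exact: s2.
  rewrite /S clampt_id//; apply: eq_bigr => i _.
  by rewrite /score_term mul0r add0r mul1r.
have kap0 : 0 < v * expR (- (2 * ((`|b0| + 1) * D + (`|h0| + 1)) * K)).
  by rewrite mulr_gt0 ?expR_gt0.
have [p [p1 p2 pd]] := score_root_exists (p0 := (b0, h0))
  (is_derive_log_laplace Hk Hmu) N0 mD kap0 strong S1 S2 V0 rho1.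
have plE q : pl_equations mu A x q <->
    score1 m xi L1 q = 0 /\ score2 m xi L1 q = 0.
  by rewrite /pl_equations (derive1_log_laplace Hk Hmu).
have uniq q : pl_equations mu A x q -> p = q.
  by move=> /plE[q1 q2]; exact: (score_root_unique mono N0 V0 p1 p2 q1 q2).
have ex : mple_exists mu A x by exists p; split => //; apply/plE.
split => //.
have [mp _] : [set q | pl_equations mu A x q /\ mple_exists mu A x] (mple mu A x).
  by apply: xgetPex; exists p; split => //; apply/plE.
by rewrite -(uniq _ mp).
Qed.

End GibbsMoments.

(** * Events of high probability *)

Section HighProbability.
Context (R : realType) (d : nat -> measure_display).
Context (T : forall N, measurableType (d N)).
Context (P : forall N, set (T N) -> \bar R).
Arguments P : clear implicits.

(** An inner probability above [1 - e] is a supremum, so some measurable subset already exceeds that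
    level. *)
Lemma with_high_prob_event (E : forall N, set (T N)) (e : R) :
  with_high_prob P E -> 0 < e ->
  \forall N \near \oo, exists F, [/\ measurable F, F `<=` E N &
    ((1 - e)%:E < P N F)%E].
Proof.
move=> /fine_cvgP[fE cE] e0; move/cvgrPdist_lt : cE => /(_ _ e0) cE.
near=> N.
have fN : inner_prob (P N) (E N) \is a fin_num by near: N.
have : `|1 - fine (inner_prob (P N) (E N))| < e by near: N.
rewrite ltr_norml => /andP[_ lt1].
have /ereal_sup_gt[_ [F [mF FE] <-] PF] :
    ((1 - e)%:E < inner_prob (P N) (E N))%E.
  by rewrite -(fineK fN) lte_fin; lra.
by exists F.
Unshelve. all: by end_near. Qed.

(** The bound by one gives finiteness from above and turns the lower bounds into convergence. *)
Lemma event_with_high_prob (E : forall N, set (T N)) :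
  (forall N F, measurable F -> (P N F <= 1)%E) ->
  (forall e, 0 < e -> \forall N \near \oo,
     ((1 - e)%:E <= inner_prob (P N) (E N))%E) ->
  with_high_prob P E.
Proof.
move=> P1 H.
have i1 N : (inner_prob (P N) (E N) <= 1)%E.
  by apply: ge_ereal_sup => _ [F [mF _] <-]; exact: P1.
have fin e N : ((1 - e)%:E <= inner_prob (P N) (E N))%E ->
    inner_prob (P N) (E N) \is a fin_num.
  move=> h; rewrite fin_numE; apply/andP; split; apply/eqP => E0.
    by rewrite E0 in h.
  by have := i1 N; rewrite E0.
apply/fine_cvgP; split.
  by apply: filterS (H 1 ltr01) => N; exact: fin.
apply/cvgrPdist_le => e e0; apply: filterS (H e e0) => N h /=.
have := i1 N; move: (h); rewrite -(fineK (fin _ _ h)) !lee_fin => lo hi.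
by rewrite ger0_norm; lra.
Qed.

End HighProbability.

(** * Choice of constants and the rate of the estimator *)

Theorem theorem1p3 (R : realType) (km kp : R)
    (mu : probability (measurableTypeR R) R)
    (A : forall N : nat, tensor3 R N) (beta0 h0 gamma : R)
    (Hk : km < kp)
    (Hmu : mu `[km, kp]%classic = 1%E)
    (Hkm : measure_support mu km) (Hkp : measure_support mu kp)
    (HA : forall N, admissible (A N))
    (Hgamma : 0 < gamma)
    (HAgamma : forall N (i : 'I_N), \sum_j \sum_k A N i j k <= gamma)
    (HT : omega_p (fun N => gibbs mu (A N) beta0 h0)
            (fun N => @field_variance R N (A N))
            (fun N => N%:R `^ (- (2 / 7)))) :
  with_high_prob (fun N => gibbs mu (A N) beta0 h0)
    (fun N => [set x | mple_exists mu (A N) x])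
  /\ bigO_p (fun N => gibbs mu (A N) beta0 h0)
    (fun N x => Num.max `|(mple mu (A N) x).1 - beta0|
                        `|(mple mu (A N) x).2 - h0|)
    (fun N x => N%:R `^ (- (1 / 2)) * (field_variance (A N) x)^-1).
Proof.
have [v v0 hv] := clamp_nondegenerate Hk Hkm Hkp.
set K := clamp_bound km kp.
pose D := gamma * K ^+ 2.
pose eta := v * expR (- (2 * ((`|beta0| + 1) * D + (`|h0| + 1)) * K))
  / (1 + 2 * D ^+ 2).
have eta0 : 0 < eta.
  by rewrite divr_gt0 ?mulr_gt0 ?expR_gt0//; have := sqr_ge0 D; lra.
pose C := second_moment_bound km kp beta0 gamma 1 0 +
  second_moment_bound km kp beta0 gamma 0 1.
(* One measurable event carries both existence and the rate, with [M] depending on [e] but not on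
   [N]. *)
have main e : 0 < e -> exists2 M, 0 < M & \forall N \near \oo,
    exists F : set (N.-tuple (measurableTypeR R)), [/\ measurable F,
      ((1 - e)%:E <= gibbs mu (A N) beta0 h0 F)%E &
      forall x, F x -> mple_exists mu (A N) x /\
        Num.max `|(mple mu (A N) x).1 - beta0| `|(mple mu (A N) x).2 - h0| <=
        M * `|N%:R `^ (- (1 / 2)) * (field_variance (A N) x)^-1| ].
  move=> e0; have e20 : 0 < e / 2 by rewrite divr_gt0.
  (* Makes the Chebyshev error at most [e / 2]; [|C| + 1] is positive whatever the sign of [C]. *)
  pose M2 := 2 * (`|C| + 1) / e.
  have M20 : 0 < M2 by rewrite divr_gt0// mulr_gt0// ltr_wpDl.
  pose M0 := Num.sqrt M2.
  have M00 : 0 < M0 by rewrite sqrtr_gt0.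
  exists (2 * M0 / eta); first by rewrite divr_gt0// mulr_gt0.
  have c0 : 0 < 2 * M0 / eta by rewrite divr_gt0// mulr_gt0.
  near=> N.
  have N0 : (0 < N)%N by near: N; exists 1%N.
  (* The constant in the variance hypothesis equals the announced rate constant, which is what gives
     [rho < 1] below. *)
  have [G [mG GT PG]] : exists G : set (N.-tuple (measurableTypeR R)), [/\ measurable G,
      G `<=` [set x | 2 * M0 / eta * N%:R `^ (- (2 / 7)) < field_variance (A N) x] &
      ((1 - e / 2)%:E < gibbs mu (A N) beta0 h0 G)%E].
    by near: N; exact: with_high_prob_event (HT _ c0) e20.
  have n0 : 0 < N%:R :> R by rewrite ltr0n.
  have n1 : 1 <= N%:R :> R by rewrite ler1n.
  set r := N%:R `^ (- (1 / 2)) : R.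
  have r0 : 0 < r by exact: powR_gt0.
  have rr : r ^+ 2 = N%:R^-1.
    rewrite expr2 -powRD; last by apply/implyP => _; rewrite gt_eqF.
    rewrite (_ : - (1 / 2) + - (1 / 2) = -1); last by field.
    by rewrite powR_inv1 ?ltW.
  (* The hypothesis on the variance is used only through this comparison: N^(-1/2) is at most
     N^(-2/7). *)
  have r27 : r <= N%:R `^ (- (2 / 7)) by apply: ler_powR => //; lra.
  (* As [r] is N^(-1/2), this threshold is [M0] times the square root of N, the order of the
     scores. *)
  pose s := M0 * (N%:R * r).
  have s0 : 0 < s by rewrite !mulr_gt0.
  have s2 : s ^+ 2 = M2 * N%:R.
    rewrite /s !exprMn rr sqr_sqrtr ?ltW//; congr (_ * _).
    by field; rewrite gt_eqF.
  exists (G `&` score_event km kp mu (A N) beta0 h0 s); split.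
  - by apply: measurableI => //; exact: measurable_score_event.
  - apply: le_trans (gibbs_score_event Hk Hmu beta0 h0 (HA N) (@HAgamma N) mG s0).
    rewrite -/C s2.
    have CM : N%:R * C / (M2 * N%:R) <= e / 2.
      rewrite ler_pdivrMr; last exact: mulr_gt0.
      rewrite /M2.
      have -> : e / 2 * (2 * (`|C| + 1) / e * N%:R) = N%:R * (`|C| + 1).
        by field; rewrite gt_eqF.
      by rewrite ler_pM2l// (le_trans (ler_norm C))// lerDl.
    apply: (le_trans _ (leeD2r _ (ltW PG))).
    by rewrite -EFinB lee_fin; lra.
  move=> x [/GT/= Tx Sx].
  have T0 : 0 < field_variance (A N) x.
    by rewrite (lt_trans _ Tx)// mulr_gt0// powR_gt0.
  have rhoE : 2 * s / (eta * (N%:R * field_variance (A N) x)) =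
      2 * M0 / eta * (r * (field_variance (A N) x)^-1).
    by rewrite /s; field; rewrite !gt_eqF.
  rewrite [`|r / _|]ger0_norm; last by rewrite divr_ge0// ltW.
  rewrite -rhoE.
  apply: (score_event_mple Hk Hmu (HA N) (@HAgamma N) v0 hv N0 T0 Sx).
  (* The radius is below 1 since [2 * M0 / eta * r] is at most the lower bound for the variance on
     [G]. *)
  rewrite -/K -/D -/eta rhoE mulrA ltr_pdivrMr// mul1r (le_lt_trans _ Tx)//.
  by rewrite ler_pM2l.
split.
  apply: event_with_high_prob => [N F|e e0]; first exact: (gibbs_le1 Hk Hmu).
  have [M _ H] := main e e0; apply: filterS H => N [F [mF PF HF]].
  apply: (le_trans PF); apply: ereal_sup_ubound; exists F => //; split => // x.
  by case/HF.
move=> e e0; have [M M0 H] := main e e0; exists M.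
apply: filterS H => N [F [mF PF HF]].
apply: (le_trans PF); apply: ereal_sup_ubound; exists F => //.
split => // x /HF[_ h] /=.
by rewrite [X in X <= _]ger0_norm// le_max normr_ge0.
Unshelve. all: by end_near. Qed.
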